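(* Let $\mathcal M$ be a duoidal category in which idempotent morphisms split and such that the functor $H:=\big(\mathcal M^I\xrightarrow{U^I}\mathcal M\xrightarrow{(-)\circ J}\mathcal M_J\big)$ is fully faithful. Then for any bimonoid $A$ in $\mathcal M$, the following assertions are equivalent. (i) The unit $\eta:I\to A$ is an $A$-Galois extension. (ii) The natural transformation $\beta$ with components $$\beta_Q:\ (Q\bullet I)\circ A\xrightarrow{(Q\bullet I)\circ\Delta}(Q\bullet I)\circ(A\bullet A)\xrightarrow{\zeta}(Q\circ A)\bullet(I\circ A)\cong(Q\circ A)\bullet A\xrightarrow{\gamma\bullet A}Q\bullet A,$$ for right $A$-modules $(Q,\gamma)$, is an isomorphism. (iii) The comparison functor $K=(-)\circ A:\mathcal M^I\to\mathcal M^A_A$ is an equivalence.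
   Context: Composition is written with a dot, an object also denotes its identity morphism, $\cong$ denotes associativity and unit constraints, and $\alpha$ denotes associators $(X\,Y)\,Z\to X\,(Y\,Z)$. Duoidal category: a category $\mathcal M$ with two monoidal structures $(\circ,I)$ and $(\bullet,J)$, morphisms $\delta:I\to I\bullet I$, $\varpi:J\circ J\to J$, $\tau:I\to J$, and a natural transformation $\zeta_{A,B,C,D}:(A\bullet B)\circ(C\bullet D)\to(A\circ C)\bullet(B\circ D)$ such that: (1) $(J,\varpi,\tau)$ is a monoid in $(\mathcal M,\circ,I)$ and $(I,\delta,\tau)$ is a comonoid in $(\mathcal M,\bullet,J)$; (2) up to associativity constraints, $\zeta_{A\circ C,B\circ D,E,F}.(\zeta_{A,B,C,D}\circ(E\bullet F))=\zeta_{A,B,C\circ E,D\circ F}.((A\bullet B)\circ\zeta_{C,D,E,F})$ and $(\zeta_{A,B,D,E}\bullet(C\circ F)).\zeta_{A\bullet B,C,D\bullet E,F}=((A\circ D)\bullet\zeta_{B,C,E,F}).\zeta_{A,B\bullet C,D,E\bullet F}$; (3) up to unit constraints, $\zeta_{I,I,A,B}.(\delta\circ(A\bullet B))$, $\zeta_{A,B,I,I}.((A\bullet B)\circ\delta)$, $(\varpi\bullet(A\circ B)).\zeta_{J,A,J,B}$ and $((A\circ B)\bullet\varpi).\zeta_{A,J,B,J}$ are identity morphisms (of $A\bullet B$, $A\bullet B$, $A\circ B$, $A\circ B$, respectively). Bimonoid: an object $A$ with a monoid structure $(\mu,\eta)$ in $(\mathcal M,\circ,I)$ and a comonoid structure $(\Delta,\varepsilon)$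 in $(\mathcal M,\bullet,J)$ such that $\Delta.\mu=(\mu\bullet\mu).\zeta.(\Delta\circ\Delta)$, $\varepsilon.\mu=\varpi.(\varepsilon\circ\varepsilon)$, $\Delta.\eta=(\eta\bullet\eta).\delta$, $\varepsilon.\eta=\tau$. $\mathcal M_A$, $\mathcal M_J$: right modules over the monoids $A$, $J$ in $(\mathcal M,\circ,I)$. $\mathcal M^I$, $\mathcal M^A$: right comodules over the comonoids $I$, $A$ in $(\mathcal M,\bullet,J)$. $U^I$ is the forgetful functor; $(-)\circ J:\mathcal M\to\mathcal M_J$ is the free module functor. $\mathcal M^A_A$ is the category of $A$-Hopf modules: triples $(X,\gamma:X\circ A\to X,\rho:X\to X\bullet A)$ with $(X,\gamma)$ a right $A$-module and $(X,\rho)$ a right $A$-comodule such that $\rho.\gamma=(\gamma\bullet\mu).\zeta.(\rho\circ\Delta)$; morphisms are both $A$-module and $A$-comodule morphisms. The functor $K$ sends an $I$-comodule $(Z,\rho)$ to $Z\circ A$ with the free $A$-action $(Z\circ\mu).\alpha$ and the $A$-coaction $Z\circ A\xrightarrow{\rho\circ A}(Z\bullet I)\circ A\xrightarrow{(Z\bullet I)\circ\Delta}(Z\bullet I)\circ(A\bullet A)\xrightarrow{\zeta}(Z\circ A)\bullet(I\circ A)\cong(Z\circ A)\bullet A$, and sends a morphism $f$ to $f\circ A$. For an $A$-Hopf module $X$, the $A$-coinvariant part $X^{c}$ is the equalizer in $\mathcal M^I$ (if it exists) of the morphisms $\varphi^0=\rho\bullet I$ and $\varphi^1=((X\bullet\eta)\bullet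 I).\alpha^{-1}.(X\bullet\delta)$ from $X\bullet I$ to $(X\bullet A)\bullet I$ (both cofree $I$-comodules). $\eta:I\to A$ is an $A$-Galois extension if the following hold, where $A$ is regarded as a comodule monoid over itself via $\Delta$ (i.e. a monoid in $\mathcal M^A$, which is monoidal via $\circ$) and as a Hopf module via $\mu$ and $\Delta$: the coinvariant part of every $A$-Hopf module exists; there is a morphism $\iota:I\to A\bullet I$ exhibiting $I$ as the equalizer in $\mathcal M^I$ of $\varphi^0,\varphi^1:A\bullet I\rightrightarrows(A\bullet A)\bullet I$, such that $\eta$ is the composite $I\xrightarrow{\iota}A\bullet I\xrightarrow{A\bullet\tau}A\bullet J\cong A$ (and the monoid structure of $I$ is the one for which $\iota$ is a morphism of monoids, $A\bullet I$ having multiplication $(\mu\bullet I).(\cong).\zeta$ and unit $(\eta\bullet I).\delta$); for every right module $(P,\gamma)$ over the monoid $I$, the coequalizer $\pi_{P,A}:P\circ A\to P\circ_I A$ of $\gamma\circ A$ and $(P\circ\gamma').\alpha:(P\circ I)\circ A\rightrightarrows P\circ A$ exists in $\mathcal M$, where $\gamma'=\mu.(\eta\circ A):I\circ A\to A$, and it is preserved by every power of the functor $(-)\circ A:\mathcal M\to\mathcal M$; and for every right $A$-module $Q$, the unique morphism $(Q\bullet I)\circ_I A\to Q\bullet A$ whose composite with $\pi_{Q\bullet I,A}$ is the morphism $\beta_Q$ displayed in (ii) is an isomorphism. *)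

(* Defs.v *)
From Stdlib Require Import ssreflect ssrfun ProofIrrelevance.

Set Implicit Arguments.
Unset Strict Implicit.
Unset Printing Implicit Defensive.

Declare Scope cat_scope.
Delimit Scope cat_scope with cat.
Local Open Scope cat_scope.

Record Category := {
  Ob :> Type;
  Hom : Ob -> Ob -> Type;
  idm : forall X, Hom X X;
  comp : forall {X Y Z}, Hom Y Z -> Hom X Y -> Hom X Z;
  comp_idl : forall X Y (f : Hom X Y), comp (idm Y) f = f;
  comp_idr : forall X Y (f : Hom X Y), comp f (idm X) = f;
  compA : forall X Y Z W (h : Hom Z W) (g : Hom Y Z) (f : Hom X Y),
      comp (comp h g) f = comp h (comp g f) }.

Arguments Hom {c} _ _.
Arguments idm {c} _.
Arguments comp {c X Y Z} _ _.

Notation "g · f" := (comp g f) (at level 40, left associativity) : cat_scope.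
Notation "'\1_' X" := (idm X) (at level 8, X at level 2, format "'\1_' X") : cat_scope.

Definition is_iso (C : Category) (X Y : C) (f : Hom X Y) : Prop :=
  exists g : Hom Y X, g · f = \1_X /\ f · g = \1_Y.

Definition idempotents_split (C : Category) : Prop :=
  forall (X : C) (e : Hom X X), e · e = e ->
  exists (Y : C) (r : Hom X Y) (s : Hom Y X), s · r = e /\ r · s = \1_Y.

Definition is_equalizer (C : Category) (E X Y : C) (f g : Hom X Y) (e : Hom E X) : Prop :=
  f · e = g · e /\
  forall (W : C) (h : Hom W X), f · h = g · h -> exists! k : Hom W E, e · k = h.

Definition is_coequalizer (C : Category) (X Y Q : C) (f g : Hom X Y) (q : Hom Y Q) : Prop :=
  q · f = q · g /\
  forall (W : C) (h : Hom Y W), h · f = h · g -> exists! k : Hom Q W, k · q = h.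

Record Functor (C D : Category) := {
  fob :> C -> D;
  fmap : forall {X Y : C}, Hom X Y -> Hom (fob X) (fob Y);
  fmap_id : forall X, fmap (\1_X) = \1_(fob X);
  fmap_comp : forall X Y Z (g : Hom Y Z) (f : Hom X Y), fmap (g · f) = fmap g · fmap f }.

Arguments fmap {C D} _ {X Y} _.

Definition functor_id (C : Category) : Functor C C.
Proof. by refine {| fob := fun X => X; fmap := fun _ _ f => f |}. Defined.

Definition functor_comp (C D E : Category) (G : Functor D E) (F : Functor C D) : Functor C E.
Proof.
refine {| fob := fun X => G (F X); fmap := fun _ _ f => fmap G (fmap F f) |}.
- by move=> X; rewrite !fmap_id.
- by move=> X Y Z g f; rewrite !fmap_comp.
Defined.

Fixpoint functor_pow (C : Category) (F : Functor C C) (n : nat) : Functor C C :=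
  match n with
  | O => functor_id C
  | S k => functor_comp F (functor_pow F k)
  end.

Definition fully_faithful (C D : Category) (F : Functor C D) : Prop :=
  forall (X Y : C) (g : Hom (F X) (F Y)), exists! f : Hom X Y, fmap F f = g.

Record NatTrans (C D : Category) (F G : Functor C D) := {
  nat_at :> forall X : C, Hom (F X) (G X);
  nat_natural : forall X Y (f : Hom X Y), fmap G f · nat_at X = nat_at Y · fmap F f }.

Definition is_nat_iso (C D : Category) (F G : Functor C D) (t : NatTrans F G) : Prop :=
  forall X : C, is_iso (t X).

Definition is_equivalence (C D : Category) (F : Functor C D) : Prop :=
  exists (G : Functor D C)
         (u : NatTrans (functor_id C) (functor_comp G F))
         (v : NatTrans (functor_comp F G) (functor_id D)),
    is_nat_iso u /\ is_nat_iso v.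

Record Monoidal (C : Category) := {
  tens : C -> C -> C;
  tensm : forall {X Y X' Y' : C}, Hom X Y -> Hom X' Y' -> Hom (tens X X') (tens Y Y');
  tens_id : forall X Y, tensm (\1_X) (\1_Y) = \1_(tens X Y);
  tens_comp : forall X Y Z X' Y' Z' (g : Hom Y Z) (f : Hom X Y) (g' : Hom Y' Z') (f' : Hom X' Y'),
      tensm (g · f) (g' · f') = tensm g g' · tensm f f';
  unit : C;
  asc : forall X Y Z, Hom (tens (tens X Y) Z) (tens X (tens Y Z));
  asci : forall X Y Z, Hom (tens X (tens Y Z)) (tens (tens X Y) Z);
  lun : forall X, Hom (tens unit X) X;
  luni : forall X, Hom X (tens unit X);
  run : forall X, Hom (tens X unit) X;
  runi : forall X, Hom X (tens X unit);
  asciK : forall X Y Z, asc X Y Z · asci X Y Z = \1_(tens X (tens Y Z));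
  ascK : forall X Y Z, asci X Y Z · asc X Y Z = \1_(tens (tens X Y) Z);
  luniK : forall X, lun X · luni X = \1_X;
  lunK : forall X, luni X · lun X = \1_(tens unit X);
  runiK : forall X, run X · runi X = \1_X;
  runK : forall X, runi X · run X = \1_(tens X unit);
  asc_nat : forall X Y Z X' Y' Z' (f : Hom X X') (g : Hom Y Y') (h : Hom Z Z'),
      asc X' Y' Z' · tensm (tensm f g) h = tensm f (tensm g h) · asc X Y Z;
  lun_nat : forall X Y (f : Hom X Y), lun Y · tensm (\1_unit) f = f · lun X;
  run_nat : forall X Y (f : Hom X Y), run Y · tensm f (\1_unit) = f · run X;
  pentagon : forall W X Y Z,
      asc W X (tens Y Z) · asc (tens W X) Y Z
      = tensm (\1_W) (asc X Y Z) · asc W (tens X Y) Z · tensm (asc W X Y) (\1_Z);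
  triangle : forall X Y,
      tensm (\1_X) (lun Y) · asc X unit Y = tensm (run X) (\1_Y) }.

Arguments tens {C} _ _ _.
Arguments tensm {C} _ {X Y X' Y'} _ _.
Arguments unit {C} _.
Arguments asc {C} _ _ _ _.
Arguments asci {C} _ _ _ _.
Arguments lun {C} _ _.
Arguments luni {C} _ _.
Arguments run {C} _ _.
Arguments runi {C} _ _.

Lemma compr (C : Category) (X Y Y' Z : C) (f : Hom Y Z) (g : Hom X Y)
    (f' : Hom Y' Z) (g' : Hom X Y') :
  f · g = f' · g' -> forall W (k : Hom W X), f · (g · k) = f' · (g' · k).
Proof. by move=> E W k; rewrite -!compA E. Qed.

Lemma compr1 (C : Category) (X Y Z : C) (f : Hom Y Z) (g : Hom X Y) (h : Hom X Z) :
  f · g = h -> forall W (k : Hom W X), f · (g · k) = h · k.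
Proof. by move=> E W k; rewrite -!compA E. Qed.

Section Coherence.
Context (C : Category) (T : Monoidal C).
Implicit Types W X Y Z : C.
Local Notation "X ⊗ Y" := (tens T X Y) (at level 40, left associativity).
Local Notation "f <⊗> g" := (tensm T f g) (at level 38, left associativity).

Lemma tensr_comp X Y Z (W : C) (g : Hom Y Z) (f : Hom X Y) :
  (g · f) <⊗> \1_W = (g <⊗> \1_W) · (f <⊗> \1_W).
Proof. by rewrite -tens_comp comp_idl. Qed.

Lemma tensl_comp X Y Z (W : C) (g : Hom Y Z) (f : Hom X Y) :
  \1_W <⊗> (g · f) = (\1_W <⊗> g) · (\1_W <⊗> f).
Proof. by rewrite -tens_comp comp_idl. Qed.

Lemma asci_nat X Y Z X' Y' Z' (f : Hom X X') (g : Hom Y Y') (h : Hom Z Z') :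
  asci T X' Y' Z' · (f <⊗> (g <⊗> h)) = (f <⊗> g) <⊗> h · asci T X Y Z.
Proof.
rewrite -[LHS]comp_idr -(asciK T X Y Z) compA -(compr (asc_nat T f g h)).
by rewrite -compA ascK comp_idl.
Qed.

Lemma unit_cancel_l X Y (f g : Hom X Y) :
  \1_(unit T) <⊗> f = \1_(unit T) <⊗> g -> f = g.
Proof.
move=> E; rewrite -[f]comp_idr -[g]comp_idr -(luniK T X) -!compA.
by rewrite -!lun_nat E.
Qed.

Lemma unit_cancel_r X Y (f g : Hom X Y) :
  f <⊗> \1_(unit T) = g <⊗> \1_(unit T) -> f = g.
Proof.
move=> E; rewrite -[f]comp_idr -[g]comp_idr -(runiK T X) -!compA.
by rewrite -!run_nat E.
Qed.

Lemma epi_iso X Y Z (f g : Hom Y Z) (p : Hom X Y) (q : Hom Y X) :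
  p · q = \1_Y -> f · p = g · p -> f = g.
Proof. by move=> pq E; rewrite -[f]comp_idr -[g]comp_idr -pq -!compA E. Qed.

Lemma mono_iso X Y Z (f g : Hom X Y) (p : Hom Y Z) (q : Hom Z Y) :
  q · p = \1_Y -> p · f = p · g -> f = g.
Proof. by move=> qp E; rewrite -[f]comp_idl -[g]comp_idl -qp !compA E. Qed.

Lemma lun_tens X Y : lun T (X ⊗ Y) · asc T (unit T) X Y = lun T X <⊗> \1_Y.
Proof.
apply: unit_cancel_l.
apply: (@epi_iso _ _ _ _ _ (asc T _ _ _ · (asc T _ _ _ <⊗> \1_Y))
          ((asci T _ _ _ <⊗> \1_Y) · asci T (unit T) (unit T ⊗ X) Y)).
  rewrite compA (compr1 (h := \1_((unit T ⊗ (unit T ⊗ X)) ⊗ Y))) ?comp_idl ?asciK //.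
  by rewrite -tens_comp asciK comp_idl tens_id.
rewrite tensl_comp !compA.
have P := pentagon T (unit T) (unit T) X Y; rewrite !compA in P.
rewrite -P -compA triangle -(tens_id T X Y) -asc_nat.
by rewrite -(compr (asc_nat T _ _ _)) -tens_comp triangle comp_idl.
Qed.

Lemma run_tens X Y : (\1_X <⊗> run T Y) · asc T X Y (unit T) = run T (X ⊗ Y).
Proof.
apply: unit_cancel_r.
apply: (@mono_iso _ _ _ _ _ (asc T _ _ _) (asci T _ _ _)); first exact: ascK.
rewrite tensr_comp -compA asc_nat -(triangle T (X ⊗ Y)) -(triangle T Y) !(tensl_comp, compA).
have P := pentagon T X Y (unit T) (unit T); rewrite !compA in P.
by rewrite -P -(tens_id T X Y) (compr (asc_nat T _ _ _)).
Qed.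

Lemma lun_run_unit : lun T (unit T) = run T (unit T).
Proof.
apply: unit_cancel_r.
rewrite -lun_tens -triangle; congr (_ · _).
apply: (@mono_iso _ _ _ _ _ (lun T _) (luni T _)); first exact: lunK.
by rewrite lun_nat.
Qed.

End Coherence.

Record Monoid (C : Category) (T : Monoidal C) (A : C) := {
  mul : Hom (tens T A A) A;
  one : Hom (unit T) A;
  mul_assoc : mul · tensm T mul (\1_A) = mul · tensm T (\1_A) mul · asc T A A A;
  mul_one_l : mul · tensm T one (\1_A) = lun T A;
  mul_one_r : mul · tensm T (\1_A) one = run T A }.

Record Comonoid (C : Category) (T : Monoidal C) (A : C) := {
  comul : Hom A (tens T A A);
  counit : Hom A (unit T);
  comul_assoc : asc T A A A · tensm T comul (\1_A) · comul = tensm T (\1_A) comul · comul;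
  comul_counit_l : lun T A · tensm T counit (\1_A) · comul = \1_A;
  comul_counit_r : run T A · tensm T (\1_A) counit · comul = \1_A }.

Definition is_monoid_hom (C : Category) (T : Monoidal C) (A B : C)
    (SA : Monoid T A) (SB : Monoid T B) (f : Hom A B) : Prop :=
  f · mul SA = mul SB · tensm T f f /\ f · one SA = one SB.

Definition is_module (C : Category) (T : Monoidal C) (A : C) (S : Monoid T A)
    (X : C) (g : Hom (tens T X A) X) : Prop :=
  g · tensm T g (\1_A) = g · tensm T (\1_X) (mul S) · asc T X A A /\
  g · tensm T (\1_X) (one S) = run T X.

Definition is_comodule (C : Category) (T : Monoidal C) (A : C) (S : Comonoid T A)
    (X : C) (r : Hom X (tens T X A)) : Prop :=
  asc T X A A · tensm T r (\1_A) · r = tensm T (\1_X) (comul S) · r /\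
  run T X · tensm T (\1_X) (counit S) · r = \1_X.

Section ModuleCategory.
Context (C : Category) (T : Monoidal C) (A : C) (S : Monoid T A).

Record Module := {
  mod_ob :> C;
  act : Hom (tens T mod_ob A) mod_ob;
  actP : is_module S act }.

Record ModuleHom (X Y : Module) := {
  mod_map :> Hom X Y;
  mod_mapP : mod_map · act X = act Y · tensm T mod_map (\1_A) }.

Lemma ModuleHom_eq (X Y : Module) (f g : ModuleHom X Y) : mod_map f = mod_map g -> f = g.
Proof.
case: f g => [f Pf] [g Pg] /= E; subst g; by rewrite (proof_irrelevance _ Pf Pg).
Qed.

Definition mod_id (X : Module) : ModuleHom X X.
Proof. by exists (\1_X); rewrite tens_id comp_idl comp_idr. Defined.

Definition mod_comp (X Y Z : Module) (g : ModuleHom Y Z) (f : ModuleHom X Y) : ModuleHom X Z.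
Proof.
exists (g · f); by rewrite compA mod_mapP tensr_comp -!compA mod_mapP.
Defined.

Definition ModCat : Category.
Proof.
refine {| Ob := Module; Hom := ModuleHom; idm := mod_id; comp := mod_comp |}.
- by move=> X Y f; apply: ModuleHom_eq; exact: comp_idl.
- by move=> X Y f; apply: ModuleHom_eq; exact: comp_idr.
- by move=> X Y Z W h g f; apply: ModuleHom_eq; exact: compA.
Defined.

Definition free_act (Z : C) : Hom (tens T (tens T Z A) A) (tens T Z A) :=
  tensm T (\1_Z) (mul S) · asc T Z A A.

Lemma free_actP Z : is_module S (free_act Z).
Proof.
rewrite /free_act; split.
  rewrite tensr_comp !compA (compr (asc_nat T _ _ _)) (compr1 (esym (tens_comp T _ _ _ _))).
  rewrite comp_idl mul_assoc.
  rewrite -(tens_id T Z A) (compr (asc_nat T _ _ _)).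
  rewrite pentagon !tensl_comp !compA; congr (_ · _).
by rewrite compA -(tens_id T Z A) asc_nat -compA -tens_comp comp_idl mul_one_r run_tens.
Qed.

Definition free_module (Z : C) : Module := {| actP := free_actP Z |}.

Definition free_map (Y Z : C) (f : Hom Y Z) : ModuleHom (free_module Y) (free_module Z).
Proof.
exists (tensm T f (\1_A)) => /=; rewrite /free_act.
rewrite compA asc_nat tens_id -!compA -!tens_comp.
by rewrite !comp_idl !comp_idr.
Defined.

Definition free_functor : Functor C ModCat.
Proof.
refine {| fob := free_module : C -> ModCat; fmap := free_map |}.
- by move=> X; apply: ModuleHom_eq; exact: tens_id.
- by move=> X Y Z g f; apply: ModuleHom_eq; exact: tensr_comp.
Defined.

End ModuleCategory.

Definition restrict_module (C : Category) (T : Monoidal C) (A B : C)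
    (SA : Monoid T A) (SB : Monoid T B) (f : Hom A B) (fP : is_monoid_hom SA SB f)
    (X : Module SB) : Module SA.
Proof.
refine {| mod_ob := X; act := act X · tensm T (\1_X) f |}.
case: fP => fM f1; case: (actP X) => XM X1; split.
- rewrite !compA (compr1 (esym (tensl_comp T _ _ _))) fM tensl_comp.
  rewrite compA -asc_nat -(compA (act X) (tensm T _ (mul SB))) -(compA (act X · _)) -XM !compA.
  congr (_ · _); rewrite -!tens_comp.
  by rewrite !comp_idl !comp_idr.
- by rewrite compA -tensl_comp f1 X1.
Defined.

Section ComoduleCategory.
Context (C : Category) (T : Monoidal C) (A : C) (S : Comonoid T A).

Record Comodule := {
  com_ob :> C;
  coact : Hom com_ob (tens T com_ob A);
  coactP : is_comodule S coact }.

Record ComoduleHom (X Y : Comodule) := {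
  com_map :> Hom X Y;
  com_mapP : coact Y · com_map = tensm T com_map (\1_A) · coact X }.

Lemma ComoduleHom_eq (X Y : Comodule) (f g : ComoduleHom X Y) : com_map f = com_map g -> f = g.
Proof.
case: f g => [f Pf] [g Pg] /= E; subst g; by rewrite (proof_irrelevance _ Pf Pg).
Qed.

Definition com_id (X : Comodule) : ComoduleHom X X.
Proof. by exists (\1_X); rewrite tens_id comp_idl comp_idr. Defined.

Definition com_comp (X Y Z : Comodule) (g : ComoduleHom Y Z) (f : ComoduleHom X Y) :
  ComoduleHom X Z.
Proof.
exists (g · f); by rewrite -compA com_mapP tensr_comp !compA com_mapP.
Defined.

Definition ComodCat : Category.
Proof.
refine {| Ob := Comodule; Hom := ComoduleHom; idm := com_id; comp := com_comp |}.
- by move=> X Y f; apply: ComoduleHom_eq; exact: comp_idl.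
- by move=> X Y f; apply: ComoduleHom_eq; exact: comp_idr.
- by move=> X Y Z W h g f; apply: ComoduleHom_eq; exact: compA.
Defined.

Definition forget_functor : Functor ComodCat C.
Proof. by refine {| fob := (com_ob : ComodCat -> C); fmap := com_map |}. Defined.

Definition cofree_coact (X : C) : Hom (tens T X A) (tens T (tens T X A) A) :=
  asci T X A A · tensm T (\1_X) (comul S).

Lemma cofree_coactP X : is_comodule S (cofree_coact X).
Proof.
rewrite /cofree_coact; split.
- apply: (@mono_iso _ _ _ _ _ _ (asc T _ _ _) (asci T _ _ _)); first exact: ascK.
  rewrite !compA (compr (pentagon T X A A A)) !compA (compr1 (esym (tensr_comp T _ _ _))).
  rewrite (compr1 (asciK T X A A)) comp_idl (compr (asc_nat T _ _ _)).
  rewrite -(tens_id T X A) (compr (asc_nat T _ _ _)).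
  rewrite !(compr1 (asciK T _ _ _)) !comp_idl -!tensl_comp.
  by rewrite -comul_assoc !compA.
- rewrite !compA -(tens_id T X A) -(compr (asci_nat T _ _ _)) -tensl_comp -run_tens !compA.
  rewrite (compr1 (asciK T _ _ _)) comp_idl -tensl_comp.
  by rewrite -compA comul_counit_r tens_id.
Qed.

Definition cofree_comodule (X : C) : Comodule := {| coactP := cofree_coactP X |}.

Definition cofree_map (X Y : C) (f : Hom X Y) :
  ComoduleHom (cofree_comodule X) (cofree_comodule Y).
Proof.
exists (tensm T f (\1_A)) => /=; rewrite /cofree_coact.
rewrite -compA -asci_nat tens_id !compA -!tens_comp.
by rewrite !comp_idl !comp_idr.
Defined.

Definition cofree_coact_map (X : C) :
  ComoduleHom (cofree_comodule X) (cofree_comodule (tens T X A)).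
Proof.
exists (cofree_coact X) => /=.
have [E _] := cofree_coactP X.
by rewrite {1}/cofree_coact compA -E !compA (compr1 (ascK T _ _ _)) comp_idl.
Defined.

Lemma comul_comodule : is_comodule S (comul S).
Proof. by split; [exact: comul_assoc | exact: comul_counit_r]. Qed.

Definition regular_comodule : Comodule := {| coactP := comul_comodule |}.

End ComoduleCategory.

Definition tensor_right (C : Category) (T : Monoidal C) (A : C) : Functor C C.
Proof.
refine {| fob := fun X : C => tens T X A; fmap := fun X Y f => tensm T f (\1_A) |}.
- by move=> X; exact: tens_id.
- by move=> X Y Z g f; exact: tensr_comp.
Defined.

Record Duoidal := {
  dcat :> Category;
  wh : Monoidal dcat;
  bl : Monoidal dcat;
  Jmon : Monoid wh (unit bl);
  Icom : Comonoid bl (unit wh);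
  counit_Icom : counit Icom = one Jmon;
  zeta : forall A B C D,
      Hom (tens wh (tens bl A B) (tens bl C D)) (tens bl (tens wh A C) (tens wh B D));
  zeta_nat : forall A B C D A' B' C' D'
      (a : Hom A A') (b : Hom B B') (c : Hom C C') (d : Hom D D'),
      tensm bl (tensm wh a c) (tensm wh b d) · zeta A B C D
      = zeta A' B' C' D' · tensm wh (tensm bl a b) (tensm bl c d);
  zeta_asc_wh : forall A B C D E F,
      tensm bl (asc wh A C E) (asc wh B D F) · zeta (tens wh A C) (tens wh B D) E F
        · tensm wh (zeta A B C D) (\1_(tens bl E F))
      = zeta A B (tens wh C E) (tens wh D F) · tensm wh (\1_(tens bl A B)) (zeta C D E F)
        · asc wh (tens bl A B) (tens bl C D) (tens bl E F);
  zeta_asc_bl : forall A B C D E F,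
      asc bl (tens wh A D) (tens wh B E) (tens wh C F)
        · tensm bl (zeta A B D E) (\1_(tens wh C F)) · zeta (tens bl A B) C (tens bl D E) F
      = tensm bl (\1_(tens wh A D)) (zeta B C E F) · zeta A (tens bl B C) D (tens bl E F)
        · tensm wh (asc bl A B C) (asc bl D E F);
  zeta_delta_l : forall A B,
      tensm bl (lun wh A) (lun wh B) · zeta (unit wh) (unit wh) A B
        · tensm wh (comul Icom) (\1_(tens bl A B))
      = lun wh (tens bl A B);
  zeta_delta_r : forall A B,
      tensm bl (run wh A) (run wh B) · zeta A B (unit wh) (unit wh)
        · tensm wh (\1_(tens bl A B)) (comul Icom)
      = run wh (tens bl A B);
  zeta_varpi_l : forall A B,
      lun bl (tens wh A B) · tensm bl (mul Jmon) (\1_(tens wh A B))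
        · zeta (unit bl) A (unit bl) B
      = tensm wh (lun bl A) (lun bl B);
  zeta_varpi_r : forall A B,
      run bl (tens wh A B) · tensm bl (\1_(tens wh A B)) (mul Jmon)
        · zeta A (unit bl) B (unit bl)
      = tensm wh (run bl A) (run bl B) }.

Arguments wh {_}.
Arguments bl {_}.
Arguments Jmon {_}.
Arguments Icom {_}.
Arguments zeta {_} _ _ _ _.

Notation "X ∘ Y" := (tens wh X Y) (at level 40, left associativity) : cat_scope.
Notation "X • Y" := (tens bl X Y) (at level 40, left associativity) : cat_scope.
Notation "f <∘> g" := (tensm wh f g) (at level 38, left associativity) : cat_scope.
Notation "f <•> g" := (tensm bl f g) (at level 38, left associativity) : cat_scope.
Notation "'𝕀'" := (unit wh) : cat_scope.
Notation "'𝕁'" := (unit bl) : cat_scope.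
Notation "'δ'" := (comul Icom) : cat_scope.
Notation "'ϖ'" := (mul Jmon) : cat_scope.
Notation "'τ'" := (one Jmon) : cat_scope.

Record Bimonoid (M : Duoidal) := {
  bim_ob :> M;
  bim_mon : Monoid wh bim_ob;
  bim_com : Comonoid bl bim_ob;
  comul_mul : comul bim_com · mul bim_mon
    = (mul bim_mon <•> mul bim_mon) · zeta _ _ _ _ · (comul bim_com <∘> comul bim_com);
  counit_mul : counit bim_com · mul bim_mon = ϖ · (counit bim_com <∘> counit bim_com);
  comul_one : comul bim_com · one bim_mon = (one bim_mon <•> one bim_mon) · δ;
  counit_one : counit bim_com · one bim_mon = τ }.

Section Bimonoid.
Context (M : Duoidal) (A : Bimonoid M).

Local Notation μ := (mul (bim_mon A)).
Local Notation η := (one (bim_mon A)).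
Local Notation Δ := (comul (bim_com A)).
Local Notation ε := (counit (bim_com A)).

Record HopfModule := {
  hopf_ob :> M;
  hopf_act : Hom (hopf_ob ∘ A) hopf_ob;
  hopf_coact : Hom hopf_ob (hopf_ob • A);
  hopf_actP : is_module (bim_mon A) hopf_act;
  hopf_coactP : is_comodule (bim_com A) hopf_coact;
  hopf_compat : hopf_coact · hopf_act
    = (hopf_act <•> μ) · zeta _ _ _ _ · (hopf_coact <∘> Δ) }.

Record HopfModuleHom (X Y : HopfModule) := {
  hopf_map :> Hom X Y;
  hopf_map_act : hopf_map · hopf_act X = hopf_act Y · (hopf_map <∘> \1_A);
  hopf_map_coact : hopf_coact Y · hopf_map = (hopf_map <•> \1_A) · hopf_coact X }.

Lemma HopfModuleHom_eq (X Y : HopfModule) (f g : HopfModuleHom X Y) :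
  hopf_map f = hopf_map g -> f = g.
Proof.
case: f g => [f Pf Qf] [g Pg Qg] /= E; subst g.
by rewrite (proof_irrelevance _ Pf Pg) (proof_irrelevance _ Qf Qg).
Qed.

Definition hopf_id (X : HopfModule) : HopfModuleHom X X.
Proof. by exists (\1_X); rewrite tens_id comp_idl comp_idr. Defined.

Definition hopf_comp (X Y Z : HopfModule) (g : HopfModuleHom Y Z) (f : HopfModuleHom X Y) :
  HopfModuleHom X Z.
Proof.
exists (g · f).
- by rewrite compA hopf_map_act tensr_comp -!compA hopf_map_act.
- by rewrite -compA hopf_map_coact tensr_comp !compA hopf_map_coact.
Defined.

Definition HopfCat : Category.
Proof.
refine {| Ob := HopfModule; Hom := HopfModuleHom; idm := hopf_id; comp := hopf_comp |}.
- by move=> X Y f; apply: HopfModuleHom_eq; exact: comp_idl.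
- by move=> X Y f; apply: HopfModuleHom_eq; exact: comp_idr.
- by move=> X Y Z W h g f; apply: HopfModuleHom_eq; exact: compA.
Defined.

Definition regular_hopf : HopfModule.
Proof.
refine {| hopf_ob := A; hopf_act := μ; hopf_coact := Δ |}.
- by split; [exact: mul_assoc | exact: mul_one_r].
- exact: comul_comodule.
- exact: comul_mul.
Defined.

Definition K_coact (Z : Comodule (@Icom M)) : Hom (Z ∘ A) ((Z ∘ A) • A) :=
  (\1_(Z ∘ A) <•> lun wh A) · zeta Z 𝕀 A A · (\1_(Z • 𝕀) <∘> Δ) · (coact Z <∘> \1_A).

Lemma K_coactE Z : K_coact Z = (\1_(Z ∘ A) <•> lun wh A) · (zeta Z 𝕀 A A · (coact Z <∘> Δ)).
Proof. by rewrite /K_coact !compA -tens_comp comp_idl comp_idr. Qed.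

Lemma comul_lun : Δ · lun wh A = (lun wh A <•> lun wh A) · zeta 𝕀 𝕀 A A · (δ <∘> Δ).
Proof.
by rewrite -lun_nat -zeta_delta_l !compA -tens_comp comp_idr comp_idl.
Qed.

Lemma K_coactP Z : is_comodule (bim_com A) (K_coact Z).
Proof.
have [Z1 Z2] := coactP Z.
rewrite K_coactE; set k := zeta _ _ _ _ · _; split.
- have E1 : ((\1_(Z ∘ A) <•> lun wh A) · k) <•> \1_A · (\1_(Z ∘ A) <•> lun wh A)
          = ((\1_(Z ∘ A) <•> lun wh A) <•> lun wh A) · (k <•> \1_(𝕀 ∘ A)).
    by rewrite -!tens_comp !comp_idl !comp_idr.
  have E2 : asc bl _ _ _ · (k <•> \1_(𝕀 ∘ A)) · k
          = (\1_(Z ∘ A) <•> (zeta _ _ _ _ · (δ <∘> Δ))) · k.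
    rewrite /k tensr_comp -(tens_id wh 𝕀 A) !compA (compr (zeta_nat _ _ _ _)) tens_id.
    rewrite -!compA zeta_asc_bl !compA -!tens_comp -!compA Z1 comul_assoc.
    rewrite tensl_comp !compA -(tens_id wh Z A) (compr (zeta_nat _ _ _ _)).
    by rewrite -!tens_comp.
  rewrite !compA (compr E1) (compr (asc_nat bl _ _ _)) -(compA (asc _ _ _ _)) E2.
  rewrite !(compr1 (esym (tensl_comp bl _ _ _))).
  by rewrite comul_lun !compA.
- have L : ε · lun wh A = ϖ · (counit Icom <∘> ε).
    by rewrite -lun_nat -(mul_one_l Jmon) compA -tens_comp comp_idl comp_idr counit_Icom.
  rewrite !compA (compr1 (esym (tensl_comp bl _ _ _))) L tensl_comp /k !compA.
  rewrite -{2}(tens_id wh Z A) (compr (zeta_nat _ _ _ _)) -tens_comp.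
  rewrite -!compA zeta_varpi_r -tens_comp -!compA.
  by rewrite Z2 comul_counit_r tens_id.
Qed.

Lemma K_compat (Z : Comodule (@Icom M)) : K_coact Z · free_act (bim_mon A) Z
  = (free_act (bim_mon A) Z <•> μ) · zeta _ _ _ _ · (K_coact Z <∘> Δ).
Proof.
have L : lun wh A · (\1_𝕀 <∘> μ) · asc wh 𝕀 A A = μ · (lun wh A <∘> \1_A).
  by rewrite lun_nat compA lun_tens.
rewrite K_coactE /free_act !compA.
have -> : coact Z <∘> Δ · (\1_Z <∘> μ · asc wh Z A A)
   = (\1_(Z • 𝕀) <∘> (μ <•> μ)) · (\1_(Z • 𝕀) <∘> zeta _ _ _ _) · asc wh _ _ _ · (coact Z <∘> Δ <∘> Δ).
  rewrite !compA asc_nat -!compA -!tens_comp !comp_idl !comp_idr.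
  by rewrite comul_mul !compA.
rewrite !compA -(tens_id bl Z) -(compr (zeta_nat _ _ _ _)) (tens_id bl).
rewrite (compr1 (esym (tens_comp bl _ _ _ _))) comp_idl.
rewrite -(compA (zeta _ _ _ _)) -(compA (zeta _ _ _ _ · _)) -zeta_asc_wh !compA.
rewrite (compr1 (esym (tens_comp bl _ _ _ _))) L.
have -> : (\1_(Z ∘ A) <•> lun wh A · (zeta Z 𝕀 A A · coact Z <∘> Δ)) <∘> Δ
   = ((\1_(Z ∘ A) <•> lun wh A) <∘> (\1_A <•> \1_A)) · ((zeta Z 𝕀 A A <∘> \1_(A • A)) · (coact Z <∘> Δ <∘> Δ)).
  by rewrite -!tens_comp tens_id !comp_idl.
rewrite -(compr (zeta_nat _ _ _ _)) (compr1 (esym (tens_comp bl _ _ _ _))).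
by rewrite tens_id comp_idr.
Qed.

Definition K_ob (Z : Comodule (@Icom M)) : HopfModule :=
  {| hopf_actP := free_actP (bim_mon A) Z; hopf_coactP := K_coactP Z; hopf_compat := K_compat Z |}.

Definition K_map (Y Z : Comodule (@Icom M)) (f : ComoduleHom Y Z) :
  HopfModuleHom (K_ob Y) (K_ob Z).
Proof.
exists (f <∘> \1_A) => /=.
- exact: (mod_mapP (free_map (bim_mon A) f)).
- rewrite !K_coactE !compA -tens_comp com_mapP comp_idr.
  rewrite (compr1 (esym (tens_comp bl _ _ _ _))) comp_idl comp_idr.
  have -> : (f <•> \1_𝕀 · coact Y) <∘> Δ
     = ((f <•> \1_𝕀) <∘> (\1_A <•> \1_A)) · (coact Y <∘> Δ).
    by rewrite -!tens_comp tens_id !comp_idl.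
  rewrite -(compr (zeta_nat _ _ _ _)) (compr1 (esym (tens_comp bl _ _ _ _))) tens_id.
  by rewrite comp_idl comp_idr.
Defined.

Definition K : Functor (ComodCat (@Icom M)) HopfCat.
Proof.
refine {| fob := K_ob : ComodCat Icom -> HopfCat; fmap := K_map |}.
- by move=> X; apply: HopfModuleHom_eq; exact: tens_id.
- by move=> X Y Z g f; apply: HopfModuleHom_eq; exact: tensr_comp.
Defined.


(** The coinvariant part of [X] is the equalizer of [coinv0 X] and [coinv1 X], taken
    in the category of [𝕀]-comodules. *)
Definition coinv0 (X : HopfModule) :
  ComoduleHom (cofree_comodule Icom X) (cofree_comodule Icom (X • A)) :=
  cofree_map Icom (hopf_coact X).

Definition coinv1 (X : HopfModule) :
  ComoduleHom (cofree_comodule Icom X) (cofree_comodule Icom (X • A)).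
Proof.
exists (((\1_X <•> η) <•> \1_𝕀) · asci bl X 𝕀 𝕀 · (\1_X <•> δ)).
rewrite compA.
exact: com_mapP (com_comp (cofree_map Icom (\1_X <•> η)) (cofree_coact_map Icom X)).
Defined.

Definition has_coinvariants (X : HopfModule) : Prop :=
  exists (Xc : ComodCat Icom) (e : Hom Xc (cofree_comodule Icom X : ComodCat Icom)),
    is_equalizer (coinv0 X : Hom (_ : ComodCat Icom) _) (coinv1 X) e.

Definition bullet_act (Q : M) (g : Hom (Q ∘ A) Q) : Hom ((Q • 𝕀) ∘ (A • 𝕀)) (Q • 𝕀) :=
  (g <•> \1_𝕀) · (\1_(Q ∘ A) <•> lun wh 𝕀) · zeta Q 𝕀 A 𝕀.

Lemma bullet_actE (Q : M) (g : Hom (Q ∘ A) Q) : bullet_act g = (g <•> lun wh 𝕀) · zeta Q 𝕀 A 𝕀.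
Proof. by rewrite /bullet_act -tens_comp comp_idl comp_idr. Qed.

Lemma bullet_act_assoc (Q : M) (g : Hom (Q ∘ A) Q) :
  g · (g <∘> \1_A) = g · (\1_Q <∘> μ) · asc wh Q A A ->
  bullet_act g · (bullet_act g <∘> \1_(A • 𝕀))
  = bullet_act g · (\1_(Q • 𝕀) <∘> bullet_act μ) · asc wh _ _ _.
Proof.
move=> E; rewrite !bullet_actE tensr_comp tensl_comp -(tens_id bl A) -(tens_id bl Q) !compA.
rewrite -!(compr (zeta_nat _ _ _ _)) !(tens_id bl).
rewrite -(compA (zeta _ _ _ _)) -(zeta_asc_wh Q) !compA.
rewrite !(compr1 (esym (tens_comp bl _ _ _ _))) E.
by rewrite (compA (lun wh 𝕀)) triangle lun_run_unit.
Qed.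

Lemma bullet_act_one (Q : M) (g : Hom (Q ∘ A) Q) :
  g · (\1_Q <∘> η) = run wh Q ->
  bullet_act g · (\1_(Q • 𝕀) <∘> ((η <•> \1_𝕀) · δ)) = run wh (Q • 𝕀).
Proof.
move=> E; rewrite bullet_actE tensl_comp -{1}(tens_id bl Q) !compA.
rewrite -(compr (zeta_nat _ _ _ _)) (compr1 (esym (tens_comp bl _ _ _ _))).
by rewrite E tens_id comp_idr lun_run_unit -zeta_delta_r !compA.
Qed.

Definition bullet_monoid : Monoid wh (A • 𝕀).
Proof.
refine {| mul := bullet_act μ; one := (η <•> \1_𝕀) · δ |}.
- exact/bullet_act_assoc/mul_assoc.
- rewrite bullet_actE tensr_comp -{1}(tens_id bl A) !compA.
  rewrite -(compr (zeta_nat _ _ _ _)) (compr1 (esym (tens_comp bl _ _ _ _))).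
  by rewrite mul_one_l tens_id comp_idr -zeta_delta_l !compA.
- exact/bullet_act_one/mul_one_r.
Defined.

Definition bullet_module (Q : Module (bim_mon A)) : Module bullet_monoid.
Proof.
refine {| mod_ob := Q • 𝕀; act := bullet_act (act Q) |}.
case: (actP Q) => Q1 Q2; split; [exact: bullet_act_assoc | exact: bullet_act_one].
Defined.

Definition beta_dom : Functor (ModCat (bim_mon A)) M.
Proof.
refine {| fob := fun Q : ModCat (bim_mon A) => (mod_ob Q • 𝕀) ∘ A;
          fmap := fun Q R f => ((mod_map f <•> \1_𝕀) <∘> \1_A) |}.
- by move=> Q /=; rewrite !tens_id.
- by move=> Q R S g f /=; rewrite !tensr_comp.
Defined.

Definition beta_cod : Functor (ModCat (bim_mon A)) M.
Proof.
refine {| fob := fun Q : ModCat (bim_mon A) => mod_ob Q • A;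
          fmap := fun Q R f => mod_map f <•> \1_A |}.
- by move=> Q /=; rewrite !tens_id.
- by move=> Q R S g f /=; rewrite !tensr_comp.
Defined.

Definition beta_at (Q : Module (bim_mon A)) : Hom ((Q • 𝕀) ∘ A) (Q • A) :=
  (act Q <•> \1_A) · (\1_(Q ∘ A) <•> lun wh A) · zeta Q 𝕀 A A · (\1_(Q • 𝕀) <∘> Δ).

Definition beta : NatTrans beta_dom beta_cod.
Proof.
exists beta_at => Q R f /=; rewrite /beta_at.
rewrite !compA !(compr1 (esym (tens_comp bl _ _ _ _))) -tens_comp !(comp_idl, comp_idr).
have -> : (f <•> \1_𝕀) <∘> Δ
   = ((f <•> \1_𝕀) <∘> (\1_A <•> \1_A)) · (\1_(Q • 𝕀) <∘> Δ).
  by rewrite -!tens_comp !tens_id !comp_idl !comp_idr.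
rewrite -(compr (zeta_nat _ _ _ _)) (compr1 (esym (tens_comp bl _ _ _ _))).
by rewrite tens_id comp_idr mod_mapP.
Defined.

(** [P ∘_𝕀 A], for a right module [P] over a monoid structure [S] on [𝕀], is the
    coequalizer of the following pair, [A] being a left module via [η]. *)
Definition balance_l (S : Monoid wh 𝕀) (P : Module S) : Hom ((P ∘ 𝕀) ∘ A) (P ∘ A) :=
  act P <∘> \1_A.

Definition balance_r (S : Monoid wh 𝕀) (P : Module S) : Hom ((P ∘ 𝕀) ∘ A) (P ∘ A) :=
  (\1_P <∘> (μ · (η <∘> \1_A))) · asc wh P 𝕀 A.

Definition is_balanced_coequalizer (S : Monoid wh 𝕀) (P : Module S)
    (R : M) (p : Hom (P ∘ A) R) : Prop :=
  is_coequalizer (balance_l P) (balance_r P) p.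

Definition preserved_by_powers (S : Monoid wh 𝕀) (P : Module S)
    (R : M) (p : Hom (P ∘ A) R) : Prop :=
  forall n : nat, let F := functor_pow (tensor_right wh (bim_ob A)) n in
    is_coequalizer (fmap F (balance_l P)) (fmap F (balance_r P)) (fmap F p).

(** [S] is unique: [iota] is a comodule morphism with [(A • τ) · iota ≅ η], so it is
    [(η • 𝕀) · δ], which is split by [ε • 𝕀] up to a unit constraint; hence at most
    one monoid structure on [𝕀] makes it a morphism of monoids.  The action of [𝕀]
    on [Q • 𝕀] is obtained along [iota] from that of [A • 𝕀]. *)
Definition unit_is_Galois : Prop :=
  (forall X : HopfModule, has_coinvariants X) /\
  exists (iota : ComoduleHom (regular_comodule Icom) (cofree_comodule Icom A))
         (S : Monoid wh 𝕀) (iotaM : is_monoid_hom S bullet_monoid iota),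
    is_equalizer (coinv0 regular_hopf : Hom (_ : ComodCat Icom) _)
      (coinv1 regular_hopf) iota /\
    η = run bl A · (\1_A <•> τ) · iota /\
    (forall P : Module S, exists (R : M) (p : Hom (P ∘ A) R),
      is_balanced_coequalizer p /\ preserved_by_powers p) /\
    (forall Q : Module (bim_mon A),
      let QI := restrict_module iotaM (bullet_module Q) in
      forall (R : M) (p : Hom (QI ∘ A) R), is_balanced_coequalizer p ->
      exists f : Hom R (Q • A), unique (fun h => h · p = beta Q) f /\ is_iso f).

End Bimonoid.

Definition H (M : Duoidal) : Functor (ComodCat (@Icom M)) (ModCat (@Jmon M)) :=
  functor_comp (free_functor Jmon) (forget_functor Icom).

(* Main.v *)
From Stdlib Require Import ssreflect ssrfun ssrbool IndefiniteDescription.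
Require Import Defs.

(** The functor [(-) ∘ A] from [𝕀]-comodules to [A]-modules has the right adjoint
    [(-) • 𝕀], and [β] compares the comonad of this adjunction with the comonad
    [(-) • A] whose coalgebras are the Hopf modules.  If [β] is invertible, [K] is thus
    the comparison functor of the adjunction.  Along [β] the coinvariants pair of a Hopf
    module [X] becomes the standard pair [X • A ⇉ (X • A) • A], contractible in
    [A]-modules.  As [ε] is a monoid morphism, an [A]-linear map [Y ∘ A -> Z ∘ A]
    induces a [𝕁]-linear map [Y ∘ 𝕁 -> Z ∘ 𝕁], which is of the form [u ∘ 𝕁] by fullness
    of [H].  So the contraction lifts to [𝕀]-comodules, and splitting an idempotent there
    gives an absolute equalizer: this is Beck's theorem without any preservation
    hypothesis.

    Conversely, an equivalence [K] transports the adjunction for [(-) • A] to the one for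
    [(-) • 𝕀], so [β] is invertible.  In the definition of a Galois extension, the monoid
    structure on [𝕀] is forced to be the trivial one, so [P ∘_𝕀 A] is [P ∘ A] and the
    Galois map is [β] itself. *)

Set Implicit Arguments.
Unset Strict Implicit.
Unset Printing Implicit Defensive.

Local Open Scope cat_scope.

(** * Split equalizers obtained from contractible pairs *)

Section SplitEqualizer.
Context (C : Category).

Definition is_split_equalizer (E X Y : C) (f g : Hom X Y) (e : Hom E X)
    (r : Hom X E) (t : Hom Y X) : Prop :=
  [/\ f · e = g · e, r · e = \1_E, e · r = t · f & t · g = \1_X].

Lemma split_equalizerP (E X Y : C) (f g : Hom X Y) (e : Hom E X) r t :
  is_split_equalizer f g e r t -> is_equalizer f g e.
Proof.
case=> fe re er tg; split=> // W h fh; exists (r · h); split.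
  by rewrite -compA er compA fh -compA tg comp_idl.
by move=> k <-; rewrite -compA re comp_idl.
Qed.

Lemma contractible_split_equalizer (X Y : C) (f g : Hom X Y) (t : Hom Y X) :
  idempotents_split C -> t · g = \1_X -> f · (t · f) = g · (t · f) ->
  exists (E : C) (e : Hom E X) (r : Hom X E), is_split_equalizer f g e r t.
Proof.
move=> Csplit tg ftf.
have [|E [r [e [er re]]]] := Csplit X (t · f).
  by rewrite compA ftf -[t · (g · _)]compA tg comp_idl.
exists E, e, r; split=> //.
have -> : e = t · f · e by rewrite -er compA re comp_idr.
by rewrite -[LHS]compA -[RHS]compA ftf.
Qed.

End SplitEqualizer.

(** * Equivalences of categories *)

Lemma equivalence_full (C D : Category) (F : Functor C D) :
  is_equivalence F -> forall (X Y : C) (g : Hom (F X) (F Y)), exists f, fmap F f = g.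
Proof.
case=> G [u [v [uI vI]]] X Y g.
have Gfaithful : forall (U V : D) (a b : Hom U V), fmap G a = fmap G b -> a = b.
  move=> U V a b E; have [w [_ vw]] := vI U.
  apply: (epi_iso vw).
  by rewrite [a · _](nat_natural v a) [b · _](nat_natural v b) /= E.
have [uYi [uYK _]] := uI Y; have [uXi [_ uXK]] := uI X.
(* The preimage is [fmap G g] conjugated by [u]. It is compared with [g] under [G], which is
   faithful because [v] is invertible. *)
exists (uYi · fmap G g · u X); apply: Gfaithful.
apply: (epi_iso uXK).
rewrite [_ · u X](nat_natural u _) /= -!compA.
suff -> : u Y · uYi = \1_(G (F Y)) by rewrite comp_idl.
by have [w [wu uw]] := uI Y; rewrite -uw; congr (_ · _); rewrite -[uYi]comp_idr -uw -compA uYK comp_idl.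
Qed.

Lemma fully_faithful_equivalence (C D : Category) (F : Functor C D) :
  fully_faithful F ->
  (forall Y : D, exists (X : C) (f : Hom (F X) Y), is_iso f) ->
  is_equivalence F.
Proof.
move=> Fff Fsurj.
have faithful : forall (X Y : C) (a b : Hom X Y), fmap F a = fmap F b -> a = b.
  move=> X Y a b E; have [c [_ cE]] := Fff X Y (fmap F a).
  by rewrite -(cE a) // -(cE b).
have [G0 [v [w [wv vw]]]] : exists (G0 : D -> C) (v : forall Y, Hom (F (G0 Y)) Y)
    (w : forall Y, Hom Y (F (G0 Y))),
    (forall Y, w Y · v Y = \1_(F (G0 Y))) /\ (forall Y, v Y · w Y = \1_Y).
  (* Essential surjectivity is only an existence statement in [Prop], so the object part of the
     quasi-inverse is chosen by indefinite description, together with the isomorphism and its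
     inverse. *)
  have Q : forall Y : D, {p : {X : C & (Hom (F X) Y * Hom Y (F X))%type} |
      snd (projT2 p) · fst (projT2 p) = \1_(F (projT1 p)) /\
      fst (projT2 p) · snd (projT2 p) = \1_Y}.
    move=> Y; apply: constructive_indefinite_description.
    by have [X [f [g fg]]] := Fsurj Y; exists (existT _ X (f, g)).
  exists (fun Y => projT1 (proj1_sig (Q Y))), (fun Y => fst (projT2 (proj1_sig (Q Y)))),
    (fun Y => snd (projT2 (proj1_sig (Q Y)))).
  by split=> Y; case: (proj2_sig (Q Y)).
have L X Y (g : Hom (F X) (F Y)) : {f | fmap F f = g}.
  apply: constructive_indefinite_description.
  by have [f [fE _]] := Fff X Y g; exists f.
pose lift X Y (g : Hom (F X) (F Y)) := proj1_sig (L X Y g).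
have liftK X Y (g : Hom (F X) (F Y)) : fmap F (lift X Y g) = g := proj2_sig (L X Y g).
have Gid X : lift _ _ (w X · \1_X · v X) = \1_(G0 X).
  by apply: faithful; rewrite liftK comp_idr fmap_id.
have Gcomp X Y Z (g : Hom Y Z) (f : Hom X Y) :
    lift _ _ (w Z · (g · f) · v X) = lift _ _ (w Z · g · v Y) · lift _ _ (w Y · f · v X).
  apply: faithful; rewrite fmap_comp !liftK !compA.
  by rewrite -[v Y · (w Y · _)]compA vw comp_idl.
pose G := {| fob := G0; fmap := fun X Y f => lift _ _ (w Y · f · v X);
             fmap_id := Gid; fmap_comp := Gcomp |}.
have unat X Y (f : Hom X Y) :
    fmap (functor_comp G F) f · lift _ _ (w (F X)) = lift _ _ (w (F Y)) · f.
  apply: faithful; rewrite /= !fmap_comp !liftK !compA.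
  by rewrite vw comp_idr.
have vnat X Y (f : Hom X Y) : f · v X = v Y · fmap (functor_comp F G) f.
  by rewrite /= liftK -!compA vw comp_idl.
exists G, (@Build_NatTrans _ _ (functor_id C) (functor_comp G F)
             (fun X => lift X (G0 (F X)) (w (F X))) unat),
  (@Build_NatTrans _ _ (functor_comp F G) (functor_id D) v vnat).
split=> X /=; last by exists (w X).
exists (lift (G0 (F X)) X (v (F X))).
by split; apply: faithful; rewrite fmap_comp !liftK fmap_id.
Qed.

(** * Comodules: splitting of idempotents and the cofree adjunction *)

Section Comodules.
Context (C : Category) (T : Monoidal C) (A : C) (S : Comonoid T A).
Local Notation "X ⊗ Y" := (tens T X Y) (at level 40, left associativity).
Local Notation "f <⊗> g" := (tensm T f g) (at level 38, left associativity).

(** The splitting is taken in [C]. As the idempotent is a comodule map, the coaction of [X]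
    restricts to the summand along [s] and [r]. *)
Lemma comodule_idempotents_split : idempotents_split C -> idempotents_split (ComodCat S).
Proof.
move=> Csplit X w' /(f_equal (@com_map _ _ _ _ _ _)) /=.
have := com_mapP w'; have [] := coactP X.
set w : Hom (com_ob X) X := com_map w' => X1 X2 wP ww.
have [Y [r [s [sr rs]]]] := Csplit _ _ ww.
have ws : w · s = s by rewrite -sr compA rs comp_idr.
have rw : r · w = r by rewrite -sr -compA rs comp_idl.
have cs : (w <⊗> \1_A) · (coact X · s) = coact X · s by rewrite -compA -wP compA ws.
have YP : is_comodule S ((r <⊗> \1_A) · coact X · s).
  split.
    rewrite !tensr_comp !compA (compr1 (esym (tensr_comp T A s r))) sr cs.
    rewrite (compr (asc_nat T _ _ _)) tens_id -(compA (asc _ _ _ _)) -(compA (_ · _)) X1.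
    by rewrite !compA !(compr1 (esym (tens_comp T _ _ _ _))) !comp_idl !comp_idr.
  rewrite !compA (compr1 (esym (tens_comp T _ _ _ _))) comp_idl comp_idr.
  have -> : r <⊗> counit S = (r <⊗> \1_(unit T)) · (\1_X <⊗> counit S).
    by rewrite -tens_comp comp_idl comp_idr.
  rewrite !compA (compr (run_nat T r)) -(compA (_ <⊗> counit S)) -(compA (run T X)).
  by rewrite -(compA (run T X)) X2 comp_idl.
pose Z := {| coactP := YP |}.
have rP : coact Z · r = (r <⊗> \1_A) · coact X.
  by rewrite /= !compA sr wP (compr1 (esym (tensr_comp T A _ _))) rw.
have sP : coact X · s = (s <⊗> \1_A) · coact Z.
  by rewrite /= !compA (compr1 (esym (tensr_comp T A _ _))) sr cs.
exists Z, (@Build_ComoduleHom _ _ _ _ X Z r rP), (@Build_ComoduleHom _ _ _ _ Z X s sP).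
by split; apply: ComoduleHom_eq.
Qed.

(** Counit of the adjunction between the forgetful and the cofree functor; [cofree_lift] below is
    transposition along it. *)
Definition cofree_eval (Q : C) : Hom (Q ⊗ A) Q := run T Q · (\1_Q <⊗> counit S).

Lemma cofree_eval_nat (P Q : C) (f : Hom P Q) :
  cofree_eval Q · (f <⊗> \1_A) = f · cofree_eval P.
Proof.
rewrite /cofree_eval compA -tens_comp comp_idl comp_idr -compA -run_nat compA -tens_comp.
by rewrite comp_idl comp_idr.
Qed.

Lemma cofree_eval_coact (X : Comodule S) : cofree_eval X · coact X = \1_X.
Proof. by have [_] := coactP X. Qed.

Lemma cofree_eval_cofree_coact (Q : C) :
  (cofree_eval Q <⊗> \1_A) · cofree_coact S Q = \1_(Q ⊗ A).
Proof.
rewrite /cofree_eval /cofree_coact tensr_comp -triangle !compA (compr (asc_nat T _ _ _)).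
rewrite (compr1 (asciK T _ _ _)) comp_idl -!tensl_comp.
by rewrite -[lun _ _ · _]compA comul_counit_l tens_id.
Qed.

Definition cofree_lift (Z : Comodule S) (Q : C) (k : Hom Z Q) :
  ComoduleHom Z (cofree_comodule S Q).
Proof.
exists ((k <⊗> \1_A) · coact Z).
have [Z1 _] := coactP Z; have /= kP := com_mapP (cofree_map S k).
rewrite tensr_comp -compA kP !compA; congr (_ · _).
by rewrite -Z1 !compA (compr1 (ascK T _ _ _)) comp_idl.
Defined.

Lemma cofree_liftK (Z : Comodule S) (Q : C) (k : Hom Z Q) :
  cofree_eval Q · cofree_lift k = k.
Proof. by rewrite /= -compA cofree_eval_nat compA cofree_eval_coact comp_idr. Qed.

Lemma cofree_liftE (Z : Comodule S) (Q : C) (k : ComoduleHom Z (cofree_comodule S Q)) :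
  com_map k = cofree_lift (cofree_eval Q · k).
Proof.
rewrite /= tensr_comp compA -(com_mapP k) /= -compA.
by rewrite cofree_eval_cofree_coact comp_idl.
Qed.

Lemma cofree_ext (Z : Comodule S) (Q : C) (k l : ComoduleHom Z (cofree_comodule S Q)) :
  cofree_eval Q · k = cofree_eval Q · l -> com_map k = com_map l.
Proof. by move=> E; rewrite (cofree_liftE k) (cofree_liftE l) E. Qed.

End Comodules.

(** * The adjunction between free modules and the forgetful functor *)

Section FreeModules.
Context (C : Category) (T : Monoidal C) (A : C) (S : Monoid T A).
Local Notation "X ⊗ Y" := (tens T X Y) (at level 40, left associativity).
Local Notation "f <⊗> g" := (tensm T f g) (at level 38, left associativity).

Definition free_unit (Z : C) : Hom Z (Z ⊗ A) := (\1_Z <⊗> one S) · runi T Z.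

Lemma free_act_unit (Z : C) : free_act S Z · (free_unit Z <⊗> \1_A) = \1_(Z ⊗ A).
Proof.
rewrite /free_act /free_unit tensr_comp !compA (compr (asc_nat T _ _ _)).
rewrite (compr1 (esym (tensl_comp T _ _ _))) mul_one_l (compr1 (triangle T _ _)).
by rewrite -tensr_comp runiK tens_id.
Qed.

Lemma free_hom_expand (Z X : C) (g : Hom (X ⊗ A) X) (u : Hom (Z ⊗ A) X) :
  u · free_act S Z = g · (u <⊗> \1_A) -> u = g · ((u · free_unit Z) <⊗> \1_A).
Proof. by move=> uP; rewrite tensr_comp -compA -uP compA free_act_unit comp_idr. Qed.

Lemma free_unit_hom (Z X : C) (g : Hom (X ⊗ A) X) (f : Hom Z X) :
  is_module S g -> g · (f <⊗> \1_A) · free_unit Z = f.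
Proof.
case=> _ g1; rewrite /free_unit !compA (compr1 (esym (tens_comp T _ _ _ _))).
have -> : (f · \1_Z) <⊗> (\1_A · one S) = (\1_X <⊗> one S) · (f <⊗> \1_(unit T)).
  by rewrite -tens_comp !comp_idl !comp_idr.
by rewrite -!compA g1 run_nat compA runiK comp_idr.
Qed.

Lemma free_lift_act (Z X : C) (g : Hom (X ⊗ A) X) (f : Hom Z X) :
  is_module S g ->
  g · (f <⊗> \1_A) · free_act S Z = g · ((g · (f <⊗> \1_A)) <⊗> \1_A).
Proof.
case=> gA _; rewrite tensr_comp -[RHS]compA gA /free_act !compA asc_nat tens_id.
by rewrite !(compr1 (esym (tens_comp T _ _ _ _))) !comp_idl !comp_idr.
Qed.

End FreeModules.

(** * [β] as a comparison of comonads *)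

Section Beta.
Context (M : Duoidal) (A : Bimonoid M).

Local Notation μ := (mul (bim_mon A)).
Local Notation η := (one (bim_mon A)).
Local Notation Δ := (comul (bim_com A)).
Local Notation ε := (counit (bim_com A)).
Local Notation "'ζ'" := (@zeta M _ _ _ _).

Lemma K_coact_nat (Y Z : Comodule (@Icom M)) (f : ComoduleHom Y Z) :
  K_coact A Z · (f <∘> \1_A) = ((f <∘> \1_A) <•> \1_A) · K_coact A Y.
Proof. exact: hopf_map_coact (K_map A f). Qed.

(** Counit of the adjunction of [(-) ∘ A], from [𝕀]-comodules to [A]-modules, with its right adjoint
    [(-) • 𝕀]. *)
Definition beta_counit (Q : Module (bim_mon A)) : Hom ((Q • 𝕀) ∘ A) Q :=
  act Q · (cofree_eval Icom Q <∘> \1_A).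

Lemma beta_counit_act (Q : Module (bim_mon A)) :
  beta_counit Q · free_act (bim_mon A) (Q • 𝕀) = act Q · (beta_counit Q <∘> \1_A).
Proof. by apply: free_lift_act; exact: actP. Qed.

(** Presents [β] as the transpose of [beta_counit] for the cofree [A]-comodule adjunction. Its
    behaviour under evaluation and coaction follows formally from this. *)
Lemma beta_atE (Q : Module (bim_mon A)) :
  beta_at Q = (beta_counit Q <•> \1_A) · K_coact A (cofree_comodule Icom Q).
Proof.
rewrite K_coactE (compr1 (esym (tens_comp bl _ _ _ _))) comp_idr comp_idl /beta_counit.
have -> : (act Q · (cofree_eval Icom Q <∘> \1_A)) <•> lun wh A
   = (act Q <•> lun wh A) · ((cofree_eval Icom Q <∘> \1_A) <•> (\1_𝕀 <∘> \1_A)).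
  by rewrite -tens_comp tens_id comp_idr.
rewrite compA (compr (zeta_nat _ _ _ _)) -tens_comp tens_id comp_idl /=.
rewrite cofree_eval_cofree_coact /beta_at !compA (compr1 (esym (tens_comp bl _ _ _ _))).
by rewrite comp_idr comp_idl.
Qed.

Lemma beta_cofree (Q : Module (bim_mon A)) (Z : Comodule (@Icom M))
    (k : ComoduleHom Z (cofree_comodule Icom Q)) :
  beta_at Q · (k <∘> \1_A) = ((beta_counit Q · (k <∘> \1_A)) <•> \1_A) · K_coact A Z.
Proof. by rewrite beta_atE compA (K_coact_nat k) tensr_comp !compA. Qed.

Definition K_comodule (Z : Comodule (@Icom M)) : Comodule (bim_com A) :=
  {| coactP := K_coactP A Z |}.

Lemma cofree_eval_beta (Q : Module (bim_mon A)) :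
  cofree_eval (bim_com A) Q · beta_at Q = beta_counit Q.
Proof.
rewrite beta_atE.
exact: (cofree_liftK (Z := K_comodule (cofree_comodule Icom Q)) (beta_counit Q)).
Qed.

Lemma beta_coact (Q : Module (bim_mon A)) :
  cofree_coact (bim_com A) Q · beta_at Q
  = (beta_at Q <•> \1_A) · K_coact A (cofree_comodule Icom Q).
Proof.
have := com_mapP (cofree_lift (Z := K_comodule (cofree_comodule Icom Q)) (beta_counit Q)).
by rewrite /= -beta_atE.
Qed.

(** * The comonad [(-) • A] lifted to [A]-modules, with Hopf modules as coalgebras *)

Definition diag_act (Q : Module (bim_mon A)) : Hom ((Q • A) ∘ A) (Q • A) :=
  (act Q <•> μ) · ζ · (\1_(Q • A) <∘> Δ).

(** Associativity comes from [zeta_asc_wh] and multiplicativity of [Δ], the unit law from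
    [zeta_delta_r] and [comul_one]. *)
Lemma diag_actP (Q : Module (bim_mon A)) : is_module (bim_mon A) (diag_act Q).
Proof.
have [Q1 Q2] := actP Q; rewrite /diag_act; split.
- have -> : ((act Q <•> μ) · ζ · (\1_(Q • A) <∘> Δ)) <∘> \1_A
     = ((act Q <•> μ) <∘> \1_A) · (ζ <∘> \1_A) · ((\1_(Q • A) <∘> Δ) <∘> \1_A).
    by rewrite -!tens_comp !comp_idl.
  rewrite !compA.
  have -> : (\1_(Q • A) <∘> Δ) · (((act Q <•> μ) <∘> \1_A) · ((ζ <∘> \1_A) · ((\1_(Q • A) <∘> Δ) <∘> \1_A)))
   = ((act Q <•> μ) <∘> (\1_A <•> \1_A)) · ((ζ <∘> \1_(A • A)) · ((\1_(Q • A) <∘> Δ) <∘> Δ)).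
    by rewrite -!tens_comp tens_id !comp_idl !comp_idr.
  rewrite -(compr (zeta_nat _ _ _ _)) (compr1 (esym (tens_comp bl _ _ _ _))) Q1 mul_assoc.
  rewrite tens_comp compA -(compA ζ) -(compA (asc _ _ _ _ <•> _)).
  rewrite -[(asc _ _ _ _ <•> _) · _]compA zeta_asc_wh.
  rewrite tens_comp !compA (compr (zeta_nat _ _ _ _)) tens_id.
  rewrite (compr1 (esym (tensl_comp wh _ _ _))) asc_nat.
  rewrite (compr1 (esym (tensl_comp wh _ _ _))) -comul_mul.
  by rewrite (compr1 (esym (tensl_comp wh _ _ _))).
- rewrite !compA -tensl_comp comul_one tensl_comp -(tens_id bl) (compr1 (esym (zeta_nat _ _ _ _))).
  rewrite !compA (compr1 (esym (tens_comp bl _ _ _ _))) Q2 mul_one_r tens_id.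
  by rewrite -zeta_delta_r !compA.
Qed.

Definition diag_module (Q : Module (bim_mon A)) : Module (bim_mon A) :=
  {| actP := diag_actP Q |}.

Lemma diag_act_comp (Q : Module (bim_mon A)) (X : M) (f : Hom X (Q • A)) :
  diag_act Q · (f <∘> \1_A) = (act Q <•> μ) · ζ · (f <∘> Δ).
Proof. by rewrite /diag_act !compA -tens_comp comp_idl comp_idr. Qed.

(** Linearity of the counit of the lifted comonad: [ε] is multiplicative and [zeta_varpi_r] absorbs
    [ϖ]. *)
Lemma cofree_eval_diag_act (Q : Module (bim_mon A)) :
  cofree_eval (bim_com A) Q · diag_act Q = act Q · (cofree_eval (bim_com A) Q <∘> \1_A).
Proof.
rewrite /cofree_eval /diag_act !compA (compr1 (esym (tens_comp bl _ _ _ _))) comp_idl counit_mul.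
have -> : act Q <•> (ϖ · (ε <∘> ε))
   = (act Q <•> \1_𝕁) · (\1_(Q ∘ A) <•> ϖ) · ((\1_Q <∘> \1_A) <•> (ε <∘> ε)).
  by rewrite -!tens_comp tens_id !comp_idl !comp_idr.
rewrite !compA (compr (zeta_nat _ _ _ _)) (compr (run_nat bl _)).
rewrite -(compA (run bl _)) (compr1 (zeta_varpi_r _ _)) -!tens_comp.
by rewrite -[run bl A · _]compA comul_counit_r comp_idr.
Qed.

Lemma beta_act (Q : Module (bim_mon A)) :
  beta_at Q · free_act (bim_mon A) (Q • 𝕀) = diag_act Q · (beta_at Q <∘> \1_A).
Proof.
rewrite diag_act_comp beta_atE [LHS]compA (K_compat A (cofree_comodule Icom Q)).
rewrite !compA (compr1 (esym (tens_comp bl _ _ _ _))) beta_counit_act comp_idl.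
have -> : (act Q · (beta_counit Q <∘> \1_A)) <•> μ
   = (act Q <•> μ) · ((beta_counit Q <∘> \1_A) <•> (\1_A <∘> \1_A)).
  by rewrite -tens_comp tens_id comp_idr.
by rewrite compA (compr (zeta_nat _ _ _ _)) -tens_comp tens_id comp_idl.
Qed.

Lemma diag_cofree_compat (Q : Module (bim_mon A)) :
  cofree_coact (bim_com A) Q · diag_act Q
  = (diag_act Q <•> μ) · ζ · (cofree_coact (bim_com A) Q <∘> Δ).
Proof.
have ΔA : (Δ <•> \1_A) · Δ = asci bl A A A · (\1_A <•> Δ) · Δ.
  by rewrite !compA -comul_assoc !compA (compr1 (ascK bl _ _ _)) comp_idl.
rewrite /cofree_coact /diag_act.
(* Both sides are brought to the form [((act Q <•> μ) <•> μ)] after two copies of [ζ] and an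
   iterated [Δ]. Coassociativity and [zeta_asc_bl] then identify the remaining factors. *)
have -> : asci bl Q A A · (\1_Q <•> Δ) · ((act Q <•> μ) · ζ · (\1_(Q • A) <∘> Δ))
   = ((act Q <•> μ) <•> μ) · (asci bl _ _ _ · (\1_(Q ∘ A) <•> ζ) · ζ
       · ((\1_Q <•> Δ) <∘> ((\1_A <•> Δ) · Δ))).
  rewrite !compA (compr1 (esym (tens_comp bl _ _ _ _))) comul_mul comp_idl.
  have -> : act Q <•> (μ <•> μ · ζ · (Δ <∘> Δ))
     = (act Q <•> (μ <•> μ)) · ((\1_(Q ∘ A) <•> ζ) · ((\1_Q <∘> \1_A) <•> (Δ <∘> Δ))).
    by rewrite -!tens_comp tens_id !comp_idl !comp_idr !compA.
  rewrite !compA (compr (asci_nat bl _ _ _)) (compr (zeta_nat _ _ _ _)) -tens_comp.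
  by rewrite comp_idr.
have -> : (act Q <•> μ · ζ · (\1_(Q • A) <∘> Δ)) <•> μ
   = ((act Q <•> μ) <•> μ) · (ζ <•> \1_(A ∘ A)) · ((\1_(Q • A) <∘> Δ) <•> (\1_A <∘> \1_A)).
  by rewrite -!tens_comp tens_id !comp_idr.
rewrite !compA; congr (_ · _); rewrite (compr (zeta_nat _ _ _ _)) -tens_comp.
rewrite tens_id comp_idl ΔA compA tens_comp.
apply: (mono_iso (ascK bl _ _ _)).
by rewrite (compr1 (asciK bl _ _ _)) comp_idl -!compA zeta_asc_bl !compA
  (compr1 (esym (tens_comp wh _ _ _ _))) !asciK !tens_id comp_idl.
Qed.

Definition cofree_hopf (Q : Module (bim_mon A)) : HopfModule A :=
  {| hopf_actP := diag_actP Q; hopf_coactP := cofree_coactP (bim_com A) Q;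
     hopf_compat := diag_cofree_compat Q |}.

Definition hopf_module (X : HopfModule A) : Module (bim_mon A) := {| actP := hopf_actP X |}.

Definition hopf_comodule (X : HopfModule A) : Comodule (bim_com A) := {| coactP := hopf_coactP X |}.

Lemma hopf_coact_act (X : HopfModule A) :
  hopf_coact X · hopf_act X = diag_act (hopf_module X) · (hopf_coact X <∘> \1_A).
Proof. by rewrite diag_act_comp hopf_compat. Qed.

(** * The coinvariants pair transported along [β] *)

Lemma beta_coinv0 (X : HopfModule A) :
  beta_at (diag_module (hopf_module X)) · (coinv0 X <∘> \1_A)
  = (hopf_coact X <•> \1_A) · beta_at (hopf_module X).
Proof.
(* By Hopf compatibility the coaction is linear for the diagonal action, and [coinv0] is its image
   under [(-) • 𝕀]; the claim is naturality of [β] at this map. *)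
pose f := @Build_ModuleHom _ _ _ _ (hopf_module X) (diag_module (hopf_module X)) (hopf_coact X)
  (hopf_coact_act X).
by rewrite [RHS](nat_natural (beta A) (f : Hom (hopf_module X : ModCat _) (diag_module _))).
Qed.

Lemma cofree_eval_coinv1 (X : HopfModule A) :
  cofree_eval Icom (X • A) · coinv1 X = \1_X <•> η.
Proof.
have E : cofree_eval Icom (X • 𝕀) · (asci bl X 𝕀 𝕀 · (\1_X <•> δ)) = \1_(X • 𝕀).
  exact: cofree_eval_coact (cofree_comodule Icom X).
by rewrite /= [_ · (\1_X <•> δ)]compA -[LHS]compA cofree_eval_nat compA E comp_idr.
Qed.

(** Both sides are transposes, so it suffices to compare the maps they come from. Evaluating
    [coinv1] inserts [η], which the diagonal action absorbs by the left unit law, leaving [β]. *)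
Lemma beta_coinv1 (X : HopfModule A) :
  beta_at (diag_module (hopf_module X)) · (coinv1 X <∘> \1_A)
  = cofree_coact (bim_com A) X · beta_at (hopf_module X).
Proof.
rewrite beta_cofree [RHS](beta_coact (hopf_module X)); congr (_ <•> _ · _).
rewrite /beta_counit compA -tensr_comp cofree_eval_coinv1 diag_act_comp.
have -> : (\1_X <•> η) <∘> Δ = ((\1_X <•> η) <∘> (\1_A <•> \1_A)) · (\1_(X • 𝕀) <∘> Δ).
  by rewrite -!tens_comp tens_id !comp_idl !comp_idr.
rewrite !compA -(compr (zeta_nat _ _ _ _)) (compr1 (esym (tens_comp bl _ _ _ _))).
rewrite tens_id comp_idr mul_one_l /beta_at !compA (compr1 (esym (tens_comp bl _ _ _ _))).
by rewrite comp_idl comp_idr.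
Qed.

Lemma coinv_coact (X : HopfModule A) :
  (hopf_coact X <•> \1_A) · hopf_coact X = cofree_coact (bim_com A) X · hopf_coact X.
Proof. by have := com_mapP (cofree_lift (Z := hopf_comodule X) (\1_X)); rewrite /= tens_id comp_idl. Qed.

Lemma cofree_eval_beta_coinv0 (X : HopfModule A) :
  cofree_eval (bim_com A) (X • A) · (beta_at (diag_module (hopf_module X)) · (coinv0 X <∘> \1_A))
  = hopf_coact X · beta_counit (hopf_module X).
Proof. by rewrite beta_coinv0 (compr (cofree_eval_nat _ _)) -cofree_eval_beta. Qed.

Lemma cofree_eval_beta_coinv1 (X : HopfModule A) :
  cofree_eval (bim_com A) (X • A) · (beta_at (diag_module (hopf_module X)) · (coinv1 X <∘> \1_A))
  = beta_at (hopf_module X).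
Proof.
by rewrite beta_coinv1 (compr1 (cofree_eval_coact (cofree_comodule (bim_com A) X))) comp_idl.
Qed.

(** * Descent of [A]-linear maps to [𝕀]-comodules along [H] *)

Section FullyFaithful.
Context (H_ff : fully_faithful (H M)).

(** [ε] collapses [t] to the map that [u] induces on free [𝕁]-modules, written without
    mentioning [𝕁]-linearity. *)
Definition lifts (Y Z : M) (u : Hom Y Z) (t : Hom (Y ∘ A) (Z ∘ A)) : Prop :=
  (\1_Z <∘> ε) · t = u <∘> ε.

Lemma lifts_id (Y : M) : lifts (\1_Y) (\1_(Y ∘ A)).
Proof. exact: comp_idr. Qed.

Lemma lifts_free (Y Z : M) (u : Hom Y Z) : lifts u (u <∘> \1_A).
Proof. by rewrite /lifts -tens_comp comp_idl comp_idr. Qed.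

Lemma lifts_comp (X Y Z : M) (v : Hom Y Z) (u : Hom X Y) s t :
  lifts v s -> lifts u t -> lifts (v · u) (s · t).
Proof.
rewrite /lifts => vs ut; rewrite -compA vs.
have -> : v <∘> ε = (v <∘> \1_𝕁) · (\1_Y <∘> ε) by rewrite -tens_comp comp_idl comp_idr.
by rewrite compA ut -tens_comp comp_idl.
Qed.

(** Since [ε · η = τ], the map [u ∘ ε] determines the restriction of [u ∘ 𝕁] along the unit of the
    free [𝕁]-module, hence [u ∘ 𝕁] itself by linearity. Faithfulness of [H] concludes. *)
Lemma lifts_inj (Y Z : Comodule (@Icom M)) (u v : ComoduleHom Y Z) (s t : Hom (Y ∘ A) (Z ∘ A)) :
  lifts u s -> lifts v t -> s = t -> com_map u = com_map v.
Proof.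
rewrite /lifts => us vt st; have E : u <∘> ε = v <∘> ε by rewrite -us -vt st.
have uE (w : ComoduleHom Y Z) : w <∘> \1_𝕁
    = free_act Jmon Z · (((w <∘> ε) · free_unit (bim_mon A) Y) <∘> \1_𝕁).
  rewrite [LHS](free_hom_expand (mod_mapP (free_map Jmon w))) /=; congr (_ · (_ <∘> _)).
  rewrite /free_unit !(compr1 (esym (tens_comp wh _ _ _ _))) !comp_idr.
  by rewrite counit_one comp_idl.
have [c [_ cE]] := @H_ff Y Z (fmap (H M) (u : Hom (Y : ComodCat Icom) Z)).
rewrite -(cE u) // (cE v) //; apply: ModuleHom_eq => /=.
by rewrite (uE u) (uE v) E.
Qed.

(** Restrict [t] to the generators [Y], compose with [ε] and extend [𝕁]-linearly; fullness of [H]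
    makes the result [u ∘ 𝕁]. That [u] lifts [t] uses multiplicativity of [ε]. *)
Lemma lifts_exists (Y Z : Comodule (@Icom M)) (t : Hom (Y ∘ A) (Z ∘ A)) :
  t · free_act (bim_mon A) Y = free_act (bim_mon A) Z · (t <∘> \1_A) ->
  exists u : ComoduleHom Y Z, lifts u t.
Proof.
move=> /free_hom_expand; set a := t · _ => tE.
pose b := (\1_Z <∘> ε) · a.
have bP := free_lift_act b (free_actP Jmon Z).
have [u [/(f_equal (@mod_map _ _ _ _ _ _)) /= uE _]] :=
  @H_ff Y Z (@Build_ModuleHom _ _ _ _ (free_module Jmon Y) (free_module Jmon Z) _ bP).
exists u; rewrite /lifts.
have -> : u <∘> ε = (u <∘> \1_𝕁) · (\1_Y <∘> ε) by rewrite -tens_comp comp_idl comp_idr.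
rewrite uE tE /free_act !compA -tens_comp comp_idl comp_idr /b.
have -> : (\1_Z <∘> ε · a) <∘> ε = ((\1_Z <∘> ε) <∘> ε) · (a <∘> \1_A).
  by rewrite -tens_comp comp_idr.
rewrite (compr (asc_nat wh _ _ _)) !(compr1 (esym (tensl_comp wh _ _ _))).
by rewrite counit_mul.
Qed.

(** * The coinvariants pair is contractible when [β] is invertible *)

Section BetaIso.
Context (betaI : is_nat_iso (beta A)).

Lemma beta_inv (Q : Module (bim_mon A)) : exists bi : Hom (Q • A) ((Q • 𝕀) ∘ A),
  bi · beta_at Q = \1_((Q • 𝕀) ∘ A) /\ beta_at Q · bi = \1_(Q • A).
Proof. exact: betaI Q. Qed.

(** After composing with the invertible [β] at [diag_module], this is coassociativity of the
    coaction of [X]. *)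
Lemma coinv_beta_inv (X : HopfModule A) bi :
  beta_at (hopf_module X) · bi = \1_(X • A) ->
  (coinv0 X <∘> \1_A) · (bi · hopf_coact X) = (coinv1 X <∘> \1_A) · (bi · hopf_coact X).
Proof.
move=> bKi; have [ci [ciK _]] := beta_inv (diag_module (hopf_module X)).
apply: (mono_iso ciK); rewrite -[LHS]compA -[RHS]compA beta_coinv0 beta_coinv1.
rewrite (compA (_ <•> _)) (compA (cofree_coact _ _)) (compr1 bKi).
by rewrite comp_idl coinv_coact.
Qed.

(** Applying [ε] to the last factor contracts [X • A ⇉ (X • A) • A] linearly. Transported along [β]
    it lifts to a comodule map, and [lifts_inj] carries the identities over. The last clause
    identifies the idempotent with [β⁻¹ · hopf_coact X · beta_counit], so that it can be compared
    with a splitting given in advance. *)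
Lemma coinv_contraction (X : HopfModule A) :
  exists t : ComoduleHom (cofree_comodule Icom (X • A)) (cofree_comodule Icom X),
  [/\ com_map t · coinv1 X = \1_(X • 𝕀),
      coinv0 X · (com_map t · coinv0 X) = coinv1 X · (com_map t · coinv0 X) &
      forall s, beta_at (hopf_module X) · s = hopf_coact X · beta_counit (hopf_module X) ->
        lifts (com_map t · coinv0 X) s].
Proof.
have [bi [biK bKi]] := beta_inv (hopf_module X).
set b := beta_at (diag_module (hopf_module X)).
set ev := cofree_eval (bim_com A) (X • A).
pose t := bi · (ev · b).
have bi_act : bi · diag_act (hopf_module X) = free_act (bim_mon A) (X • 𝕀) · (bi <∘> \1_A).
  apply: (mono_iso biK); rewrite -[LHS]compA bKi comp_idl -[RHS]compA (beta_act (hopf_module X)).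
  by rewrite (compA (diag_act _)) -tensr_comp bKi tens_id comp_idr.
have tP : t · free_act (bim_mon A) ((X • A) • 𝕀) = free_act (bim_mon A) (X • 𝕀) · (t <∘> \1_A).
  have /= bP := beta_act (diag_module (hopf_module X)).
  have /= evP := cofree_eval_diag_act (diag_module (hopf_module X)).
  rewrite /t (compA bi) (compA ev) bP (compr evP) (compr bi_act).
  by rewrite -(tensr_comp wh A ev b) -(tensr_comp wh A bi).
have [u uP] := lifts_exists (Y := cofree_comodule Icom (X • A)) (Z := cofree_comodule Icom X) tP.
have t1 : t · (coinv1 X <∘> \1_A) = \1_((X • 𝕀) ∘ A).
  by rewrite /t (compA bi) (compA ev) cofree_eval_beta_coinv1.
have t0 : t · (coinv0 X <∘> \1_A) = bi · (hopf_coact X · beta_counit (hopf_module X)).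
  by rewrite /t (compA bi) (compA ev) cofree_eval_beta_coinv0.
exists u; split.
- exact: (lifts_inj (u := com_comp u (coinv1 X)) (v := com_id _)
    (lifts_comp uP (lifts_free _)) (lifts_id _) t1).
- apply: (lifts_inj (u := com_comp (coinv0 X) (com_comp u (coinv0 X)))
    (v := com_comp (coinv1 X) (com_comp u (coinv0 X)))
    (lifts_comp (lifts_free _) (lifts_comp uP (lifts_free _)))
    (lifts_comp (lifts_free _) (lifts_comp uP (lifts_free _)))).
  by rewrite t0 -[bi · _]compA (compr (coinv_beta_inv bKi)).
- move=> s sE; suff -> : s = t · (coinv0 X <∘> \1_A) by apply: lifts_comp uP (lifts_free _).
  by rewrite t0 -sE -compA biK comp_idl.
Qed.

Lemma coinv_split (idem_split : idempotents_split M) (X : HopfModule A) :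
  exists (E : Comodule Icom) (e : ComoduleHom E (cofree_comodule Icom X)) r t,
  is_split_equalizer (coinv0 X : Hom (_ : ComodCat Icom) _) (coinv1 X)
    (e : Hom (E : ComodCat Icom) _) r t.
Proof.
have [t [t1 t0 _]] := coinv_contraction X.
have [||E [e [r erP]]] :=
  contractible_split_equalizer (f := coinv0 X : Hom (_ : ComodCat Icom) _)
  (g := coinv1 X) (t := t) (comodule_idempotents_split (S := Icom) idem_split).
- by apply: ComoduleHom_eq; exact: t1.
- by apply: ComoduleHom_eq; exact: t0.
- by exists E, e, r, t.
Qed.

(** * Adjoint transposes of Hopf module maps; [K] is fully faithful *)

Definition hopf_transpose (Z : Comodule (@Icom M)) (X : HopfModule A)
    (k : HopfModuleHom (K_ob A Z) X) : ComoduleHom Z (cofree_comodule Icom X) :=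
  cofree_lift (hopf_map k · free_unit (bim_mon A) Z).

Lemma beta_counit_transpose (Z : Comodule (@Icom M)) (X : HopfModule A)
    (k : HopfModuleHom (K_ob A Z) X) :
  beta_counit (hopf_module X) · (hopf_transpose k <∘> \1_A) = k.
Proof.
rewrite /beta_counit compA -tensr_comp cofree_liftK.
by rewrite [RHS](free_hom_expand (hopf_map_act k)).
Qed.

Lemma beta_transpose (Z : Comodule (@Icom M)) (X : HopfModule A)
    (k : HopfModuleHom (K_ob A Z) X) :
  beta_at (hopf_module X) · (hopf_transpose k <∘> \1_A) = hopf_coact X · k.
Proof.
rewrite (beta_cofree (Q := hopf_module X) (hopf_transpose k)) beta_counit_transpose.
by rewrite [RHS]hopf_map_coact.
Qed.

(** The retraction lifts the linear map [k⁻¹ · beta_counit]. By [lifts_inj] the identities may be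
    checked on maps between free [A]-modules: the fork is coassociativity, the retraction law is
    [beta_counit_transpose], and the idempotent is identified by the last clause of
    [coinv_contraction]. *)
Lemma transpose_split (Z : Comodule (@Icom M)) (X : HopfModule A)
    (k : HopfModuleHom (K_ob A Z) X) :
  is_iso (hopf_map k) -> exists r t,
  is_split_equalizer (coinv0 X : Hom (_ : ComodCat Icom) _) (coinv1 X)
    (hopf_transpose k : Hom (Z : ComodCat Icom) _) r t.
Proof.
case=> ki [kiK kKi]; pose Q := hopf_module X; pose i := hopf_transpose k.
have [t [t1 _ t0]] := coinv_contraction X.
have bT : beta_at Q · (i <∘> \1_A) = hopf_coact X · k := beta_transpose k.
have [ci [ciK _]] := beta_inv (diag_module Q).
have riP : ki · beta_counit Q · free_act (bim_mon A) (X • 𝕀)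
    = free_act (bim_mon A) Z · ((ki · beta_counit Q) <∘> \1_A).
  rewrite (compA ki) (beta_counit_act Q) (tensr_comp wh A ki) -(compA ki) -(compA (free_act _ _)).
  congr (_ · _).
  apply: (epi_iso (p := hopf_map k <∘> \1_A) (q := ki <∘> \1_A)).
    by rewrite -tensr_comp kKi tens_id.
  rewrite compA -[act Q · _](hopf_map_act k) -compA kiK comp_idl.
  by rewrite compA -tensr_comp kiK tens_id comp_idr.
have [r rP] := lifts_exists (Y := cofree_comodule Icom X) riP.
exists r, t; split; apply: ComoduleHom_eq => /=; last exact: t1.
- apply: (lifts_inj (u := com_comp (coinv0 X) i) (v := com_comp (coinv1 X) i)
    (lifts_comp (lifts_free _) (lifts_free _)) (lifts_comp (lifts_free _) (lifts_free _))).
  apply: (mono_iso ciK); rewrite -[LHS]compA -[RHS]compA beta_coinv0 beta_coinv1.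
  by rewrite (compA (_ <•> _)) (compA (cofree_coact _ _)) bT -[LHS]compA -[RHS]compA coinv_coact.
- apply: (lifts_inj (u := com_comp r i) (v := com_id Z)
    (lifts_comp rP (lifts_free _)) (lifts_id _)).
  by rewrite compA beta_counit_transpose.
- apply: (lifts_inj (u := com_comp i r) (v := com_comp t (coinv0 X))
    (lifts_comp (lifts_free _) rP) (t0 _ _) erefl).
  by rewrite -[LHS]compA bT compA -[hopf_map k · _]compA kKi comp_idl.
Qed.

(** A priori the comodule map [f] agrees with [g] only after [ε]. The adjunction units [iY], [iZ]
    repair this: their naturality in [g], checked through [β], descends to [iZ · f = gI · iY].
    Applying [(-) ∘ A] and cancelling the split mono [iZ ∘ A] gives [f ∘ A = g]. *)
Lemma K_fully_faithful : fully_faithful (K A).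
Proof.
move=> Y Z g.
have [f fP] := lifts_exists (hopf_map_act (g : HopfModuleHom (K_ob A Y) (K_ob A Z))).
have fg : f <∘> \1_A = hopf_map g.
  set iY := hopf_transpose (hopf_id (K_ob A Y)); set iZ := hopf_transpose (hopf_id (K_ob A Z)).
  pose gI := cofree_map Icom (hopf_map g).
  have [bi [biK _]] := beta_inv (hopf_module (K_ob A Z)).
  have iZK : beta_counit (hopf_module (K_ob A Z)) · (iZ <∘> \1_A) = \1_(Z ∘ A).
    exact: beta_counit_transpose (hopf_id (K_ob A Z)).
  have iZg : (iZ <∘> \1_A) · hopf_map g = (gI <∘> \1_A) · (iY <∘> \1_A).
    pose gm := @Build_ModuleHom _ _ _ _ (hopf_module (K_ob A Y)) (hopf_module (K_ob A Z))
      (hopf_map g) (hopf_map_act g).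
    have bg : (hopf_map g <•> \1_A) · beta_at (hopf_module (K_ob A Y))
        = beta_at (hopf_module (K_ob A Z)) · (gI <∘> \1_A) :=
      nat_natural (beta A) (gm : Hom (hopf_module (K_ob A Y) : ModCat _) (hopf_module (K_ob A Z))).
    apply: (mono_iso biK); rewrite -[LHS]compA -[RHS]compA -bg (compA (_ <•> _)).
    rewrite (beta_transpose (hopf_id (K_ob A Y))) (beta_transpose (hopf_id (K_ob A Z))) /= !comp_idr.
    exact: hopf_map_coact g.
  have E := lifts_inj (u := com_comp iZ f) (v := com_comp gI iY)
    (lifts_comp (lifts_free _) fP) (lifts_comp (lifts_free _) (lifts_free _)) iZg.
  apply: (mono_iso iZK); rewrite iZg -!tensr_comp; congr (_ <∘> _).
  exact: E.
exists f; split; first exact: HopfModuleHom_eq.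
move=> f' /(f_equal (@hopf_map _ _ _ _)) /= f'g; apply: ComoduleHom_eq.
by apply: (lifts_inj (lifts_free f) (lifts_free f')); rewrite fg f'g.
Qed.

(** * Essential surjectivity of [K] *)

Lemma hopf_is_iso (X Y : HopfModule A) (k : HopfModuleHom X Y) :
  is_iso (hopf_map k) -> is_iso (k : Hom (X : HopfCat A) Y).
Proof.
case=> l [lk kl].
have lact : l · hopf_act Y = hopf_act X · (l <∘> \1_A).
  apply: (mono_iso lk); rewrite -[LHS]compA kl comp_idl -[RHS]compA hopf_map_act compA.
  by rewrite -tensr_comp kl tens_id comp_idr.
have lcoact : hopf_coact X · l = (l <•> \1_A) · hopf_coact Y.
  apply: (epi_iso kl); rewrite [LHS]compA lk comp_idr [RHS]compA hopf_map_coact -compA.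
  by rewrite -tensr_comp lk tens_id comp_idl.
exists {| hopf_map_act := lact; hopf_map_coact := lcoact |}.
by split; apply: HopfModuleHom_eq.
Qed.

Lemma K_essentially_surjective (idem_split : idempotents_split M) (X : HopfModule A) :
  exists (Z : ComodCat Icom) (f : Hom (K A Z) (X : HopfCat A)), is_iso f.
Proof.
have [E [e [r [t [de re er td]]]]] := coinv_split idem_split X.
have {}de : coinv0 X · com_map e = coinv1 X · com_map e := f_equal (@com_map _ _ _ _ _ _) de.
have {}re : com_map r · com_map e = \1_E := f_equal (@com_map _ _ _ _ _ _) re.
have {}er : com_map e · com_map r = com_map t · coinv0 X := f_equal (@com_map _ _ _ _ _ _) er.
have {}td : com_map t · coinv1 X = \1_(X • 𝕀) := f_equal (@com_map _ _ _ _ _ _) td.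
pose Q := hopf_module X.
have [bi [biK bKi]] := beta_inv Q.
pose k := beta_counit Q · (e <∘> \1_A).
have be : beta_at Q · (e <∘> \1_A) = (k <•> \1_A) · K_coact A E := beta_cofree (Q := Q) e.
have kact : k · free_act (bim_mon A) E = hopf_act X · (k <∘> \1_A).
  rewrite /k (compA (beta_counit Q)) [_ · free_act _ E](mod_mapP (free_map (bim_mon A) e)).
  rewrite -(compA (beta_counit Q)) (beta_counit_act Q) (compA (act Q)).
  by rewrite (tensr_comp wh A (beta_counit Q)).
(* Evaluating [β · (coinv0 ∘ A)] gives [hopf_coact X · beta_counit], and evaluating
   [β · (coinv1 ∘ A)] gives [β]. The two agree after [e], which equalizes the pair. *)
have kcoact : hopf_coact X · k = (k <•> \1_A) · K_coact A E.
  rewrite -be /k -(compA (hopf_coact X)) -cofree_eval_beta_coinv0.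
  set ev := cofree_eval _ _; set b := beta_at (diag_module _).
  rewrite (compA ev) (compA b) -tensr_comp de tensr_comp -(compA b) -(compA ev).
  by rewrite cofree_eval_beta_coinv1.
exists E, (@Build_HopfModuleHom _ _ (K_ob A E) X k kact kcoact).
apply: hopf_is_iso; exists ((r <∘> \1_A) · (bi · hopf_coact X)); split=> /=.
  rewrite !compA kcoact -be -(compA bi) biK comp_idl.
  by rewrite -tensr_comp re tens_id.
(* Here [e · r] becomes [t · coinv0]. On [bi · hopf_coact X], [coinv0] may be replaced by [coinv1],
   which [t] cancels. *)
rewrite /k (compA (beta_counit Q)) -(compA (e <∘> _)) -tensr_comp er tensr_comp.
rewrite (compA (t <∘> _)) (coinv_beta_inv bKi) -(compA (t <∘> _)) -tensr_comp td tens_id comp_idl.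
rewrite -(cofree_eval_beta Q) (compA (cofree_eval _ _)) (compr1 bKi) comp_idl.
exact: cofree_eval_coact (hopf_comodule X).
Qed.

Lemma beta_iso_K_equivalence : idempotents_split M -> is_equivalence (K A).
Proof.
move=> idem_split; apply: fully_faithful_equivalence; first exact: K_fully_faithful.
exact: K_essentially_surjective.
Qed.

(** * From invertible [β] to a Galois extension *)

Lemma regular_hopf_act :
  lun wh A · free_act (bim_mon A) 𝕀 = μ · (lun wh A <∘> \1_A).
Proof. by rewrite /free_act -[LHS]compA lun_nat compA lun_tens. Qed.

Lemma regular_hopf_coact :
  Δ · lun wh A = (lun wh A <•> \1_A) · K_coact A (regular_comodule Icom).
Proof.
rewrite K_coactE /= (compr1 (esym (tens_comp bl _ _ _ _))) comp_idl comp_idr.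
by rewrite comul_lun !compA.
Qed.

Definition regular_hopf_iso : HopfModuleHom (K_ob A (regular_comodule Icom)) (regular_hopf A) :=
  @Build_HopfModuleHom _ _ (K_ob A (regular_comodule Icom)) (regular_hopf A) (lun wh A)
    regular_hopf_act regular_hopf_coact.

Definition unit_monoid : Monoid (@wh M) 𝕀.
Proof.
refine {| mul := lun wh 𝕀; one := \1_𝕀 |}.
- by rewrite [RHS]compA triangle lun_run_unit.
- by rewrite tens_id comp_idr.
- by rewrite tens_id comp_idr lun_run_unit.
Defined.

Lemma one_monoid_hom (B : M) (S : Monoid wh B) : is_monoid_hom unit_monoid S (one S).
Proof.
split=> /=; last exact: comp_idr.
by rewrite -lun_nat -(mul_one_l S) compA -tens_comp comp_idl comp_idr.
Qed.

(** The unit law of [P] forces its action to be the right unit constraint, so the two maps agree by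
    the triangle identity. *)
Lemma balance_eq (S : Monoid wh 𝕀) (P : Module S) : one S = \1_𝕀 -> balance_l A P = balance_r A P.
Proof.
move=> S1; rewrite /balance_l /balance_r mul_one_l triangle; congr (_ <∘> _).
by have [_] := actP P; rewrite S1 tens_id comp_idr.
Qed.

Lemma coequalizer_refl (C : Category) (X Y : C) (f : Hom X Y) : is_coequalizer f f (\1_Y).
Proof.
split=> // W h _; exists h; split; first exact: comp_idr.
by move=> k <-; rewrite comp_idr.
Qed.

Lemma coequalizer_refl_iso (C : Category) (X Y R : C) (f g : Hom X Y) (p : Hom Y R) :
  f = g -> is_coequalizer f g p -> is_iso p.
Proof.
move=> <- [_ U]; have [q [qp _]] := U Y (\1_Y) erefl.
exists q; split=> //; have [c [_ cE]] := U R p erefl.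
by rewrite -(cE (p · q)) ?(cE (\1_R)) ?comp_idl // compA qp comp_idr.
Qed.

Lemma balanced_coequalizer_refl (S : Monoid wh 𝕀) (P : Module S) :
  one S = \1_𝕀 -> @is_balanced_coequalizer M A S P _ (\1_(P ∘ A)).
Proof. by move=> S1; rewrite /is_balanced_coequalizer balance_eq //; exact: coequalizer_refl. Qed.

Lemma preserved_by_powers_refl (S : Monoid wh 𝕀) (P : Module S) :
  one S = \1_𝕀 -> @preserved_by_powers M A S P _ (\1_(P ∘ A)).
Proof.
move=> S1; rewrite /preserved_by_powers balance_eq // => n.
by rewrite fmap_id; exact: coequalizer_refl.
Qed.

Lemma transpose_regular :
  com_map (hopf_transpose regular_hopf_iso) = (η <•> \1_𝕀) · δ.
Proof.
rewrite /= /free_unit -[lun _ _ · _]compA lun_nat compA lun_run_unit runiK comp_idr.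
by [].
Qed.

Lemma beta_iso_Galois : idempotents_split M -> unit_is_Galois A.
Proof.
move=> idem_split; split=> [X|].
  have [E [e [r [t erP]]]] := coinv_split idem_split X.
  by exists E, e; exact: split_equalizerP erP.
(* [iota] is the transpose of [K 𝕀 ≅ A]. It equals the unit of [bullet_monoid], hence is a monoid
   morphism from the trivial monoid, and [transpose_split] makes it the equalizer. *)
have iotaE := transpose_regular; set iota := hopf_transpose _ in iotaE.
have iotaM : is_monoid_hom unit_monoid (bullet_monoid A) iota.
  by rewrite iotaE; exact: (one_monoid_hom (bullet_monoid A)).
have regularI : is_iso (hopf_map regular_hopf_iso).
  by exists (luni wh A); split; [exact: lunK | exact: luniK].
have [r [t iotaS]] := transpose_split regularI.
exists iota, unit_monoid, iotaM; split; first exact: split_equalizerP iotaS.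
split.
  rewrite -counit_Icom [RHS](cofree_liftK (Z := regular_comodule Icom)) /= /free_unit.
  by rewrite -[RHS]compA lun_nat compA lun_run_unit runiK comp_idr.
split=> [P|Q QI R p pP].
  exists (P ∘ A), (\1_(P ∘ A)).
  by split; [exact: balanced_coequalizer_refl | exact: preserved_by_powers_refl].
(* A coequalizer of equal maps is invertible, so the Galois map is [β] composed with the inverse of
   [p]. *)
have [q [qp pq]] := coequalizer_refl_iso (balance_eq QI erefl) pP.
have [bi [biK bKi]] := beta_inv Q.
exists (beta A Q · q); split.
  split; first by rewrite compA qp comp_idr.
  by move=> h <-; rewrite compA pq comp_idr.
exists (p · bi); split.
  by rewrite compA -(compA bi) biK comp_idl.
by rewrite compA -(compA q) qp comp_idl.
Qed.

End BetaIso.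
End FullyFaithful.

(** * From a Galois extension to invertible [β] *)

Lemma one_of_bullet_monoid_hom (S : Monoid wh 𝕀) (iota : Hom 𝕀 (A • 𝕀)) :
  is_monoid_hom S (bullet_monoid A) iota -> iota = (η <•> \1_𝕀) · δ -> one S = \1_𝕀.
Proof.
case=> _ iota1 iotaE.
(* [ε • 𝕀] retracts [iota] up to a unit constraint, so [iota] can be cancelled from
   [iota · one S = iota]. *)
have iotaK : (lun bl 𝕀 · (ε <•> \1_𝕀)) · iota = \1_𝕀.
  rewrite iotaE compA (compr1 (esym (tensr_comp bl _ _ _))) counit_one -counit_Icom -compA.
  exact: comul_counit_l.
by apply: (mono_iso iotaK); rewrite iota1 comp_idr iotaE.
Qed.

(** Being a comodule map that evaluates to [η], [iota] is [(η • 𝕀) · δ], so [one S] is the identity.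
    The identity of [(Q • 𝕀) ∘ A] is then a balanced coequalizer, whose Galois map is [β]. *)
Lemma Galois_beta_iso : unit_is_Galois A -> is_nat_iso (beta A).
Proof.
case=> _ [iota [S [iotaM [_ [etaE [_ G]]]]]] Q.
have iotaE : com_map iota = (η <•> \1_𝕀) · δ.
  have E : cofree_eval Icom A · iota = η by rewrite /cofree_eval counit_Icom -etaE.
  by rewrite (cofree_liftE iota) E.
have S1 := one_of_bullet_monoid_hom iotaM iotaE.
have [f [[fb _] fI]] := G Q _ _
  (balanced_coequalizer_refl (restrict_module iotaM (bullet_module Q)) S1).
by move: fI; rewrite -fb comp_idr.
Qed.

(** * From an equivalence [K] to invertible [β] *)

Lemma K_equivalence_beta_iso : is_equivalence (K A) -> is_nat_iso (beta A).
Proof.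
move=> KE Q; have K_full := equivalence_full KE.
have [G [_ [v [_ vI]]]] := KE.
pose Z : Comodule Icom := G (cofree_hopf Q).
pose k : HopfModuleHom (K_ob A Z) (cofree_hopf Q) := v (cofree_hopf Q).
have [l [lk kl]] : is_iso (k : Hom (K A Z) (cofree_hopf Q : HopfCat A)) := vI _.
have {}kl : hopf_map k · hopf_map l = \1_(Q • A) := f_equal (@hopf_map _ _ _ _) kl.
(* [k] is transposed twice: to the [A]-linear map [c], then to the comodule map [kI]. Hence [k]
   factors through [β], and [(kI ∘ A) · l] is a right inverse of [β]. *)
pose c : Hom (Z ∘ A) Q := cofree_eval (bim_com A) Q · k.
have cP : c · free_act (bim_mon A) Z = act Q · (c <∘> \1_A).
  rewrite /c (compA (cofree_eval _ _)) [_ · free_act _ _](hopf_map_act k) /=.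
  by rewrite (compr (cofree_eval_diag_act Q)) -tensr_comp.
pose kI : ComoduleHom Z (cofree_comodule Icom Q) := cofree_lift (c · free_unit (bim_mon A) Z).
have bk : beta_at Q · (kI <∘> \1_A) = k.
  rewrite (beta_cofree (Q := Q) kI) /beta_counit (compA (act Q)) -tensr_comp.
  rewrite [cofree_eval _ _ · kI]cofree_liftK -(free_hom_expand cP) (tensr_comp bl A _ (hopf_map k)).
  rewrite compA -[_ · K_coact _ _](hopf_map_coact k) -compA cofree_eval_cofree_coact.
  exact: comp_idl.
pose b := @Build_HopfModuleHom _ _ (K_ob A (cofree_comodule Icom Q)) (cofree_hopf Q) (beta_at Q)
  (beta_act Q) (beta_coact Q).
(* The same map is a left inverse: its composite with [β] is a Hopf endomorphism of [K (Q • 𝕀)], so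
   it is [w ∘ A] by fullness. It preserves [beta_counit], which forces [w] to be the identity by
   adjunction. *)
have [w wE] := K_full (cofree_comodule Icom Q) (cofree_comodule Icom Q)
  (hopf_comp (K_map A kI) (hopf_comp (l : HopfModuleHom _ _) b)).
have {}wE : com_map w <∘> \1_A = (kI <∘> \1_A) · (hopf_map l · beta_at Q) :=
  f_equal (@hopf_map _ _ _ _) wE.
have w1 : com_map w = \1_(Q • 𝕀).
  apply: (cofree_ext (l := com_id (cofree_comodule Icom Q))); rewrite comp_idr.
  have bw : beta_counit Q · (com_map w <∘> \1_A) = beta_counit Q.
    rewrite -cofree_eval_beta (compA (cofree_eval _ _)) wE -(compA (beta_at Q)) bk.
    by rewrite -(compA (hopf_map k)) kl comp_idl.
  move: bw; rewrite /beta_counit (compA (act Q)) -tensr_comp => bw.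
  by rewrite -[LHS](free_unit_hom _ (actP Q)) bw (free_unit_hom _ (actP Q)).
exists ((kI <∘> \1_A) · l); split.
  by rewrite /= (compA (_ <∘> _)) -wE w1 tens_id.
by rewrite -[LHS]compA [_ · (kI <∘> _)]bk.
Qed.

End Beta.

Theorem theorem3p11 (M : Duoidal)
    (idem_split : idempotents_split M)
    (H_ff : fully_faithful (H M))
    (A : Bimonoid M) :
  (unit_is_Galois A <-> is_nat_iso (beta A)) /\
  (is_nat_iso (beta A) <-> is_equivalence (K A)).
Proof.
split; split.
- exact: Galois_beta_iso.
- by move=> betaI; exact: beta_iso_Galois.
- by move=> betaI; exact: beta_iso_K_equivalence.
- exact: K_equivalence_beta_iso.
Qed.
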